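(* Let $\vec n\in\mathbb{R}^3$ be a unit vector, $\vec\sigma=(\sigma_1,\sigma_2,\sigma_3)$ the Pauli matrices, $J=\vec n\cdot\frac{\vec\sigma}{2}$ and $U_\theta=e^{-i\theta J}$ for $\theta\in\Theta=[0,2\pi)$. Let $\rho=|\psi\rangle\langle\psi|=\frac12\left(I+\vec a\cdot\vec\sigma\right)$ be a pure qubit state with $\|\vec a\|=1$ and $\vec a\cdot\vec n\neq\pm1$, and let $\rho_\theta=U_\theta\rho U_\theta^\dagger$. Let $P_{\pm\frac12}=\frac12(I\pm\vec n\cdot\vec\sigma)$ be the spectral projectors of $J$ for the eigenvalues $\pm\frac12$, and define the POVM on $\Theta$ $$M_*(d\hat\theta)=\frac{d\hat\theta}{2\pi}\sum_{j,k\in\{-\frac12,\frac12\}} e^{i\hat\theta(k-j)}\,\frac{P_j\rho P_k}{\sqrt{\mathrm{Tr}[P_j\rho]\,\mathrm{Tr}[P_k\rho]}}.$$ Then for every POVM $M$ with outcomes in $\Theta$ that is covariant with respect to $\{U_\theta\}_{\theta\in\Theta}$, $$F(\theta;M)\le F(\theta;M_* ).$$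
   Context: $\Theta=[0,2\pi)$ is regarded as the group of addition modulo $2\pi$, acting on itself, with unitary representation $\theta\mapsto U_\theta$ on $\mathbb{C}^2$. A POVM $M$ with outcomes in $\Theta$ is a family of positive operators $M(B)$ indexed by Borel sets $B\subseteq\Theta$, countably additive, with $M(\Theta)=I$. It is covariant with respect to $\{U_g\}$ if $M(B g^{-1})=U_g^\dagger M(B)U_g$ for all Borel $B$ and all $g\in\Theta$, where $Bg^{-1}=\{\theta: \theta= g+\theta' \bmod 2\pi,\ \theta'\in B\}$. Given the state $\rho_\theta$, the outcome distribution is $p(d\hat\theta\mid\theta)=\mathrm{Tr}[M(d\hat\theta)\rho_\theta]$, and the (classical) Fisher information of $M$ at $\theta$ is $F(\theta;M)=\int_\Theta \left(\partial_\theta \log p(\hat\theta\mid\theta)\right)^2 p(d\hat\theta\mid\theta)$, where $p(\hat\theta\mid\theta)$ is the density of $p(d\hat\theta\mid\theta)$. *)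

(* Defs.v *)
From HB Require Import structures.
From mathcomp Require Import all_boot all_order all_algebra.
From mathcomp Require Import all_classical all_reals all_analysis.
From mathcomp Require Import complex.
Set Implicit Arguments. Unset Strict Implicit. Unset Printing Implicit Defensive.
Import Order.TTheory GRing.Theory Num.Theory.
Import numFieldNormedType.Exports.
Local Open Scope classical_set_scope.
Local Open Scope ring_scope.

Section QubitDefs.
Variable R : realType.
Local Notation C := (R[i]).

Definition Theta : set R := `[0, 2 * pi[%classic.

Definition mod2pi (x : R) : R := x - 2 * pi * (Num.floor (x / (2 * pi)))%:~R.

Definition shiftset (g : R) (B : set R) : set R :=
  [set t | exists2 t', B t' & t = mod2pi (g + t')].

Definition expi (t : R) : C := (Complex (cos t) (sin t)).

Definition dagger (A : 'M[C]_2) : 'M[C]_2 := map_mx (@conjc R) A^T.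

Definition sigma1 : 'M[C]_2 := \matrix_(i < 2, j < 2) (if i == j then 0 else 1).
Definition sigma2 : 'M[C]_2 :=
  \matrix_(i < 2, j < 2)
    (if i == j then 0 else if (i : nat) == 0%N then - (Complex 0 1) else Complex 0 1).
Definition sigma3 : 'M[C]_2 :=
  \matrix_(i < 2, j < 2) (if i == j then (if (i : nat) == 0%N then 1 else -1) else 0).

Definition sigma (k : 'I_3) : 'M[C]_2 :=
  match val k with 0%N => sigma1 | 1%N => sigma2 | _ => sigma3 end.

Definition dot_sigma (v : 'rV[R]_3) : 'M[C]_2 :=
  \sum_(k < 3) ((v 0 k)%:C)%C *: sigma k.

Definition dot3 (u v : 'rV[R]_3) : R := \sum_(k < 3) u 0 k * v 0 k.

Definition unit_vec (v : 'rV[R]_3) : Prop := dot3 v v = 1.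

Definition Pproj (n : 'rV[R]_3) (plus : bool) : 'M[C]_2 :=
  (2%:R)^-1 *: (1%:M + (if plus then 1 else -1) *: dot_sigma n).

Definition eigJ (plus : bool) : R := if plus then 2^-1 else - 2^-1.

(* U_theta = exp(-i theta J), defined by the spectral calculus of the
   Hermitian matrix J = (1/2) P_{+1/2} - (1/2) P_{-1/2} *)
Definition Uop (n : 'rV[R]_3) (t : R) : 'M[C]_2 :=
  \sum_(j : bool) expi (- t * eigJ j) *: Pproj n j.

Definition rho (a : 'rV[R]_3) : 'M[C]_2 := (2%:R)^-1 *: (1%:M + dot_sigma a).

Definition rho_t (n a : 'rV[R]_3) (t : R) : 'M[C]_2 :=
  Uop n t *m rho a *m dagger (Uop n t).

Definition cint (B : set R) (f : R -> C) : C :=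
  Complex (Rintegral lebesgue_measure B (fun x => complex.Re (f x)))
          (Rintegral lebesgue_measure B (fun x => complex.Im (f x))).

Definition Mstar_dens (n a : 'rV[R]_3) (t : R) : 'M[C]_2 :=
  ((2 * pi)^-1)%:C%C *:
  \sum_(j : bool) \sum_(k : bool)
     (expi (t * (eigJ k - eigJ j)) *
      ((Num.sqrt (complex.Re (\tr (Pproj n j *m rho a)) * complex.Re (\tr (Pproj n k *m rho a))))^-1)%:C%C)
     *: (Pproj n j *m rho a *m Pproj n k).

Definition Mstar (n a : 'rV[R]_3) (B : set R) : 'M[C]_2 :=
  \matrix_(r < 2, s < 2) cint B (fun t => Mstar_dens n a t r s).

Definition psd (A : 'M[C]_2) : Prop :=
  forall v : 'cV[C]_2, 0 <= (map_mx (@conjc R) v^T *m A *m v) 0 0.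

Definition POVM (M : set R -> 'M[C]_2) : Prop :=
  (forall B, measurable B -> B `<=` Theta -> psd (M B)) /\
  M Theta = 1%:M /\
  (forall F : nat -> set R,
     (forall k, measurable (F k)) -> (forall k, F k `<=` Theta) ->
     trivIset setT F ->
     forall r s : 'I_2,
       ((fun N : nat => complex.Re (\sum_(k < N) M (F k) r s) : R) @ \oo -->
          (complex.Re (M (\bigcup_k F k) r s) : R)) /\
       ((fun N : nat => complex.Im (\sum_(k < N) M (F k) r s) : R) @ \oo -->
          (complex.Im (M (\bigcup_k F k) r s) : R))).

Definition covariant (n : 'rV[R]_3) (M : set R -> 'M[C]_2) : Prop :=
  forall B g, measurable B -> B `<=` Theta -> Theta g ->
    M (shiftset g B) = dagger (Uop n g) *m M B *m Uop n g.

Definition regular_density (n a : 'rV[R]_3) (M : set R -> 'M[C]_2)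
    (th0 : R) (p : R -> R -> R) : Prop :=
  (forall t : R, lebesgue_measure.-integrable Theta (fun x => (p x t)%:E)) /\
  (forall (t : R) (B : set R), measurable B -> B `<=` Theta ->
     \tr (M B *m rho_t n a t) = ((Rintegral lebesgue_measure B (fun x => p x t))%:C)%C) /\
  (forall x, Theta x -> derivable (fun t => p x t) th0 1).

Definition fisher (p : R -> R -> R) (th : R) : \bar R :=
  (\int[lebesgue_measure]_(x in Theta)
     (((derive1 (fun t => ln (p x t)) th) ^+ 2 * p x th)%:E))%E.

End QubitDefs.

(* Main.v *)
Require Import Defs.
From HB Require Import structures.
From mathcomp Require Import all_boot all_order all_algebra.
From mathcomp Require Import all_classical all_reals all_analysis.
From mathcomp Require Import measurable_realfun complex.
From mathcomp Require Import ring lra.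
Set Implicit Arguments. Unset Strict Implicit. Unset Printing Implicit Defensive.
Import Order.TTheory GRing.Theory Num.Theory.
Import numFieldNormedType.Exports.
Local Open Scope classical_set_scope.
Local Open Scope ring_scope.

(* Idea. Write the state in Bloch form, rho = (1 + c N + s A)/2 with N = n.sigma and A
   the unit equatorial direction, c = a.n and s = sqrt (1 - c^2); with Q = -i N A,
   rho_t = (1 + c N + s (cos t A + sin t Q))/2. The scalar measures tr (M(.) (1 + c N))/2
   and tr (M(.))/2 are rotation invariant, hence uniform, while the pair
   (tr (M(.) A)/2, tr (M(.) Q)/2) is rotation equivariant; on the intervals [0, y[ the
   equivariance is a twisted Cauchy equation whose solutions are trigonometric. Hence the
   outcome density is (1 + r cos (x + t + phase)) / 2 pi, and positivity of M on pure
   equatorial states over short intervals gives r <= s. For Mstar, r = s. Finally the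
   Fisher information is the integral of r^2 sin^2 / (1 + r cos) / 2 pi over a period, and
   pairing x with x + pi turns it into r^2 sin^2 / (1 - r^2 cos^2), which is pointwise
   nondecreasing in r. *)

(** * Pauli matrices and rotations *)

Section Pauli.
Variable R : realType.
Local Notation C := (R[i]).
Local Notation S := (@dot_sigma R).

Lemma dot_sigmaD (v w : 'rV[R]_3) : S (v + w) = S v + S w.
Proof.
rewrite /dot_sigma -big_split; apply: eq_bigr => k _ /=.
by rewrite mxE rmorphD scalerDl.
Qed.

Lemma dot_sigmaZ (x : R) (v : 'rV[R]_3) : S (x *: v) = (x%:C)%C *: S v.
Proof.
rewrite /dot_sigma scaler_sumr; apply: eq_bigr => k _ /=.
by rewrite mxE rmorphM scalerA.
Qed.

Lemma ord2P (P : 'I_2 -> Prop) : P ord0 -> P (lift ord0 ord0) -> forall i, P i.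
Proof.
by move=> P0 P1 i; case: (unliftP ord0 i) => [j ->|-> //]; rewrite (ord1 j).
Qed.

Lemma dot_sigma_entry (v : 'rV[R]_3) (x := v 0 ord0)
    (y := v 0 (lift ord0 ord0)) (z := v 0 (lift ord0 (lift ord0 ord0))) :
  [/\ S v ord0 ord0 = Complex z 0,
      S v ord0 (lift ord0 ord0) = Complex x (- y),
      S v (lift ord0 ord0) ord0 = Complex x y &
      S v (lift ord0 ord0) (lift ord0 ord0) = Complex (- z) 0].
Proof.
rewrite /dot_sigma !summxE !big_ord_recl !big_ord0 /= !mxE /=.
by split; apply/eqP; rewrite eq_complex /=; apply/andP; split; apply/eqP;
  rewrite /x /y /z; ring.
Qed.

Lemma dot_sigma_anticomm (v w : 'rV[R]_3) :
  S v *m S w + S w *m S v = ((2 * dot3 v w)%:C)%C *: 1%:M.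
Proof.
have [v1 v2 v3 v4] := dot_sigma_entry v; have [w1 w2 w3 w4] := dot_sigma_entry w.
apply/matrixP => i j.
rewrite /dot3 !mxE !big_ord_recl !big_ord0 /=.
elim/ord2P: i; elim/ord2P: j; rewrite ?v1 ?v2 ?v3 ?v4 ?w1 ?w2 ?w3 ?w4 /=;
  apply/eqP; rewrite eq_complex /=; apply/andP; split; apply/eqP; ring.
Qed.

Lemma dagger_dot_sigma (v : 'rV[R]_3) : dagger (S v) = S v.
Proof.
have [v1 v2 v3 v4] := dot_sigma_entry v.
apply/matrixP => i j; rewrite !mxE.
elim/ord2P: i; elim/ord2P: j; rewrite ?v1 ?v2 ?v3 ?v4 /=;
  apply/eqP; rewrite eq_complex /=; apply/andP; split; apply/eqP; ring.
Qed.

End Pauli.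

Section Rotation.
Variable R : realType.
Local Notation C := (R[i]).
Variables N A : 'M[C]_2.
Hypotheses (NN : N *m N = 1%:M) (AA : A *m A = 1%:M) (NA : A *m N = - (N *m A)).
Hypotheses (dN : dagger N = N) (dA : dagger A = A).

Definition quadrature : 'M[C]_2 := (- Complex 0 1) *: (N *m A).
Definition rotation (t : R) : 'M[C]_2 :=
  ((cos (t / 2))%:C)%C *: 1%:M - (Complex 0 (sin (t / 2))) *: N.
Definition rotated (t : R) : 'M[C]_2 :=
  ((cos t)%:C)%C *: A + ((sin t)%:C)%C *: quadrature.

Lemma daggerD (X Y : 'M[C]_2) : dagger (X + Y) = dagger X + dagger Y.
Proof. by rewrite /dagger linearD /= map_mxD. Qed.

Lemma daggerM (X Y : 'M[C]_2) : dagger (X *m Y) = dagger Y *m dagger X.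
Proof. by rewrite /dagger trmx_mul map_mxM. Qed.

Lemma daggerZ (x : C) (X : 'M[C]_2) : dagger (x *: X) = conjc x *: dagger X.
Proof. by rewrite /dagger linearZ /= map_mxZ. Qed.

Lemma dagger1 : dagger (1%:M : 'M[C]_2) = 1%:M.
Proof. by rewrite /dagger trmx1 map_mx1. Qed.

Lemma dagger_rotation t : dagger (rotation t) =
  ((cos (t / 2))%:C)%C *: 1%:M + (Complex 0 (sin (t / 2))) *: N.
Proof.
rewrite /rotation daggerD -scaleNr !daggerZ dagger1 dN; congr (_ *: _ + _ *: _);
  by apply/eqP; rewrite eq_complex /= ?oppr0 ?opprK !eqxx.
Qed.

Lemma NAN : N *m A *m N = - A.
Proof. by rewrite -mulmxA NA mulmxN mulmxA NN mul1mx. Qed.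

Lemma cos_half (t : R) : cos t = cos (t / 2) ^+ 2 - sin (t / 2) ^+ 2.
Proof. by rewrite {1}[t]splitr cosD !expr2. Qed.

Lemma sin_half (t : R) : sin t = 2 * (cos (t / 2) * sin (t / 2)).
Proof. by rewrite {1}[t]splitr sinD; ring. Qed.

Lemma rotation_scalars (t : R) (c := ((cos (t / 2))%:C)%C : C)
    (s := Complex 0 (sin (t / 2)) : C) :
  [/\ ((cos t)%:C)%C = c * c + s * s, ((sin t)%:C)%C * - Complex 0 1 = - (c * s + c * s)
    & c * c - s * s = 1].
Proof.
rewrite /c /s (cos_half t) (sin_half t); split; apply/eqP;
  rewrite eq_complex /=; apply/andP; split; apply/eqP; try ring.
by rewrite -[RHS](cos2Dsin2 (t / 2)); ring.
Qed.

Lemma conj_expand (x y : C) (X : 'M[C]_2) :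
  (x *: 1%:M - y *: N) *m X *m (x *: 1%:M + y *: N) =
  (x * x) *: X + (x * y) *: (X *m N - N *m X) - (y * y) *: (N *m X *m N).
Proof.
have -> : (x *: 1%:M - y *: N) *m X = x *: X - y *: (N *m X).
  by rewrite mulmxBl -!scalemxAl mul1mx.
rewrite mulmxDr -!scalemxAr mulmx1 mulmxBl -!scalemxAl.
move: (N *m X *m N) (N *m X) (X *m N) => Y1 Y2 Y3.
by apply/matrixP => i j; rewrite !mxE; ring.
Qed.

Lemma rotationA t : rotation t *m A *m dagger (rotation t) = rotated t.
Proof.
rewrite dagger_rotation /rotation /rotated /quadrature.
have [-> E2 _] := rotation_scalars t.
rewrite scalerA E2; move: (_%:C)%C (Complex _ _) => c s.
rewrite conj_expand NAN NA; move: (N *m A) => Y.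
by apply/matrixP => i j; rewrite !mxE; ring.
Qed.

Lemma rotationN t : rotation t *m N *m dagger (rotation t) = N.
Proof.
rewrite dagger_rotation /rotation.
have [_ _ E] := rotation_scalars t.
by rewrite conj_expand subrr scaler0 addr0 NN mul1mx -scalerBl E scale1r.
Qed.

Lemma rotation1 t : rotation t *m dagger (rotation t) = 1%:M.
Proof.
rewrite -[X in X *m _]mulmx1 dagger_rotation /rotation.
have [_ _ E] := rotation_scalars t.
rewrite conj_expand mulmx1 mul1mx subrr scaler0 addr0 NN.
by rewrite -scalerBl E scale1r.
Qed.

Lemma rotatedM t : rotated t *m rotated t = 1%:M.
Proof.
rewrite -rotationA; set U := rotation t.
have UU : dagger U *m U = 1%:M by apply: mulmx1C; exact: rotation1.
rewrite !mulmxA -(mulmxA _ (dagger U) U) UU mulmx1 -(mulmxA _ A A) AA mulmx1.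
exact: rotation1.
Qed.

Lemma dagger_quadrature : dagger quadrature = quadrature.
Proof.
rewrite /quadrature daggerZ daggerM dN dA NA scalerN -scaleNr.
by congr (_ *: _); apply/eqP; rewrite eq_complex /= ?oppr0 ?opprK !eqxx.
Qed.

Lemma dagger_rotated t : dagger (rotated t) = rotated t.
Proof.
rewrite /rotated daggerD [dagger (_ *: A)]daggerZ dA.
rewrite [dagger (_ *: quadrature)]daggerZ dagger_quadrature; congr (_ *: _ + _ *: _);
  by apply/eqP; rewrite eq_complex /= oppr0 !eqxx.
Qed.

Lemma tr_anticomm (X Y : 'M[C]_2) :
  Y *m Y = 1%:M -> X *m Y = - (Y *m X) -> \tr X = 0.
Proof.
move=> YY XY; have : \tr X = - \tr X.
  rewrite -[in LHS](mulmx1 X) -YY mulmxA mxtrace_mulC mulmxA.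
  by rewrite -[X in \tr (X *m _)]opprK -XY mulNmx -mulmxA YY mulmx1 raddfN.
by move/eqP; rewrite -addr_eq0 -mulr2n mulrn_eq0 /= => /eqP.
Qed.

Lemma trN : \tr N = 0.
Proof. by apply: (@tr_anticomm _ A) => //; rewrite NA opprK. Qed.

Lemma trA : \tr A = 0.
Proof. exact: (@tr_anticomm _ N). Qed.

Lemma trNA : \tr (N *m A) = 0.
Proof. by apply: (@tr_anticomm _ N) => //; rewrite NAN mulmxA NN mul1mx. Qed.

Lemma tr_quadrature : \tr quadrature = 0.
Proof. by rewrite /quadrature linearZ /= trNA mulr0. Qed.

Lemma tr_quadratureN : \tr (quadrature *m N) = 0.
Proof. by rewrite /quadrature -scalemxAl NAN linearZ /= raddfN /= trA oppr0 mulr0. Qed.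

Lemma tr_quadratureA : \tr (quadrature *m A) = 0.
Proof. by rewrite /quadrature -scalemxAl -mulmxA AA mulmx1 linearZ /= trN mulr0. Qed.

Lemma quadrature2 : quadrature *m quadrature = 1%:M.
Proof.
rewrite /quadrature -scalemxAl -scalemxAr scalerA mulmxA NAN mulNmx AA.
rewrite scalerN -scaleNr -[RHS]scale1r; congr (_ *: _).
by apply/eqP; rewrite eq_complex /=; apply/andP; split; apply/eqP; ring.
Qed.

Lemma tr1 : \tr (1%:M : 'M[C]_2) = 2.
Proof. exact: mxtrace1. Qed.

Lemma rotation_conj t (h c s : C) :
  rotation t *m (h *: (1%:M + c *: N + s *: A)) *m dagger (rotation t) =
  h *: (1%:M + c *: N + s *: rotated t).
Proof.
have := rotation1 t; have := rotationN t; have := rotationA t.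
move: (rotation t) (dagger _) (rotated t) => U V W EA EN E1.
rewrite -scalemxAr -scalemxAl !mulmxDr !mulmxDl -!scalemxAr -!scalemxAl mulmx1.
by rewrite E1 EN EA.
Qed.

Lemma rotation_comm t : rotation t *m N = N *m rotation t.
Proof.
by rewrite /rotation mulmxBl mulmxBr -!scalemxAl -!scalemxAr mul1mx mulmx1.
Qed.

Lemma rotationQ t : rotation t *m quadrature *m dagger (rotation t) =
  ((cos t)%:C)%C *: quadrature - ((sin t)%:C)%C *: A.
Proof.
have NQ : N *m quadrature = - Complex 0 1 *: A.
  by rewrite /quadrature -scalemxAr mulmxA NN mul1mx.
have -> : rotation t *m quadrature *m dagger (rotation t) =
   - Complex 0 1 *: (N *m (rotation t *m A *m dagger (rotation t))).
  by rewrite /quadrature -scalemxAr -scalemxAl !mulmxA rotation_comm.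
have -> : N *m (rotation t *m A *m dagger (rotation t)) =
    ((cos t)%:C)%C *: (N *m A) + ((sin t)%:C)%C *: (- Complex 0 1 *: A).
  by rewrite rotationA /rotated mulmxDr -NQ -!scalemxAr.
rewrite /quadrature scalerDr !scalerA; congr (_ + _).
  by congr (_ *: _); rewrite mulrC.
rewrite -scaleNr; congr (_ *: _).
by apply/eqP; rewrite eq_complex /=; apply/andP; split; apply/eqP; ring.
Qed.

Definition ray (e : C) : 'M[C]_2 := 1%:M + e *: N.

Lemma rayM (e f : C) : ray e *m ray f = (1 + e * f) *: 1%:M + (e + f) *: N.
Proof.
rewrite /ray mulmxDl mul1mx -scalemxAl mulmxDr mulmx1 -scalemxAr NN.
move: (N) => X; apply/matrixP => i j; rewrite !mxE; ring.
Qed.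

Lemma axis_ray (e : C) : e * e = 1 -> N *m ray e = e *: ray e.
Proof.
move=> ee; rewrite /ray mulmxDr mulmx1 -scalemxAr NN scalerDr scalerA ee.
by rewrite scale1r addrC.
Qed.

Lemma ray_equator (e : C) : ray e *m A = A *m ray (- e).
Proof.
by rewrite /ray mulmxDl mulmxDr mul1mx mulmx1 -scalemxAl -scalemxAr NA scalerN scaleNr opprK.
Qed.

Lemma ray_sandwich (e f c s : C) : f * f = 1 ->
  ray e *m (1%:M + c *: N + s *: A) *m ray f =
  (1 + c * f) *: (ray e *m ray f) + s *: (A *m (ray (- e) *m ray f)).
Proof.
move=> ff; rewrite -mulmxA.
have -> : (1%:M + c *: N + s *: A) *m ray f = (1 + c * f) *: ray f + s *: (A *m ray f).
  by rewrite !mulmxDl mul1mx -!scalemxAl axis_ray// scalerA scalerDl scale1r.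
by rewrite mulmxDr -!scalemxAr !mulmxA ray_equator.
Qed.

Lemma ray_sandwich_same (e c s : C) : e * e = 1 ->
  ray e *m (1%:M + c *: N + s *: A) *m ray e = (2 * (1 + c * e)) *: ray e.
Proof.
move=> ee; rewrite ray_sandwich// !rayM mulNr ee addNr subrr !scale0r addr0.
rewrite mulmx0 scaler0 addr0 [2 * _]mulrC -scalerA; congr (_ *: _).
by rewrite /ray scalerDr scalerA mulr_natl mulr2n.
Qed.

Lemma ray_sandwich_opp (e c s : C) : e * e = 1 ->
  ray e *m (1%:M + c *: N + s *: A) *m ray (- e) =
  (2 * s) *: (A + e *: (N *m A)).
Proof.
move=> ee; have ff : - e * - e = 1 by rewrite mulrNN.
rewrite ray_sandwich// !rayM ff (mulrN e) ee !subrr !scale0r addr0 scaler0 add0r.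
rewrite [2 * s]mulrC -scalerA; congr (_ *: _).
rewrite mulmxDr -!scalemxAr mulmx1 NA; move: (N *m A) => X.
by apply/matrixP => i j; rewrite !mxE; ring.
Qed.

Lemma tr_ray (e c s : C) : e * e = 1 ->
  \tr (ray e *m (1%:M + c *: N + s *: A)) = 2 * (1 + c * e).
Proof.
move=> ee; rewrite mxtrace_mulC !mulmxDl mul1mx -!scalemxAl axis_ray//.
rewrite /ray mulmxDr mulmx1 -scalemxAr NA.
rewrite !(mxtraceD, mxtraceZ, raddfN) /= ?mxtraceZ trN trA trNA tr1.
by ring.
Qed.

Lemma tr_state (k1 k2 k3 c s : C) (t : R) :
  \tr ((k1 *: 1%:M + k2 *: A + k3 *: quadrature) *m
       (2^-1 *: (1%:M + c *: N + s *: rotated t))) =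
  k1 + s * (k2 * ((cos t)%:C)%C + k3 * ((sin t)%:C)%C).
Proof.
have trAN : \tr (A *m N) = 0 by rewrite mxtrace_mulC trNA.
have trAQ : \tr (A *m quadrature) = 0 by rewrite mxtrace_mulC tr_quadratureA.
have trQQ : \tr (quadrature *m quadrature) = 2 by rewrite quadrature2 tr1.
have := tr_quadratureN; have := tr_quadratureA; have := tr_quadrature.
rewrite /rotated; move: quadrature trAQ trQQ => Q trAQ trQQ trQ trQA trQN.
have trAA : \tr (A *m A) = 2 by rewrite AA tr1.
have tr_right (X : 'M[C]_2) (x y : C) : \tr (X *m (1%:M + c *: N + s *: (x *: A + y *: Q))) =
    \tr X + c * \tr (X *m N) + s * (x * \tr (X *m A) + y * \tr (X *m Q)).
  rewrite !mulmxDr mulmx1 -!scalemxAr mulmxDr -!scalemxAr.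
  by rewrite !(mxtraceD, mxtraceZ).
have trQ1 : \tr (1%:M *m Q) = 0 by rewrite mul1mx.
rewrite -scalemxAr mxtraceZ !mulmxDl -!scalemxAl !(mxtraceD, mxtraceZ) !tr_right.
rewrite trAA trAQ trQQ trQ trQA trQN trAN trA tr1 !mul1mx trN trA trQ.
by rewrite !(mulr0, addr0, add0r); field.
Qed.

End Rotation.

Lemma sum_bool2 (V : nmodType) (F : bool -> bool -> V) :
  \sum_(j : bool) \sum_(k : bool) F j k =
  F true true + F true false + (F false true + F false false).
Proof. by rewrite !big_bool. Qed.


Section Seed.
Variables (R : realType) (N A : 'M[R[i]]_2).
Local Notation C := (R[i]).
Hypotheses (NN : N *m N = 1%:M) (NA : A *m N = - (N *m A)).

Lemma seed_sum (c s : R) (P : bool -> 'M[C]_2) (r : 'M[C]_2) (x : R) :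
  0 < s -> s ^+ 2 = 1 - c ^+ 2 ->
  (forall b, P b = 2^-1 *: ray N (if b then 1 else -1)) ->
  r = 2^-1 *: (1%:M + (c%:C)%C *: N + (s%:C)%C *: A) ->
  (forall b : bool, complex.Re (\tr (P b *m r)) = (1 + c * (if b then 1 else -1)) / 2) ->
  \sum_(j : bool) \sum_(k : bool)
     (expi (x * (eigJ R k - eigJ R j)) *
      ((Num.sqrt (complex.Re (\tr (P j *m r)) * complex.Re (\tr (P k *m r))))^-1)%:C%C)
     *: (P j *m r *m P k) = 1%:M + rotated N A x.
Proof.
move=> s0 s2 PE rE wE; rewrite sum_bool2 !wE /=.
have hE : (2^-1 : C) = ((2^-1 : R)%:C)%C by rewrite fmorphV rmorph_nat.
have hh : (2^-1 : C) * 2 = 1 by rewrite mulVf// pnatr_eq0.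
move: (2^-1 : C) (PE) rE hE hh => h {}PE rE hE hh.
have same e u : e * e = 1 -> 1 + (c%:C)%C * e = u -> (h *: ray N e) *m r *m (h *: ray N e) =
    (u * (h * h)) *: ray N e.
  move=> ee <-; rewrite rE -!scalemxAl -!scalemxAr -scalemxAl ray_sandwich_same//.
  rewrite !scalerA; congr (_ *: _).
  by rewrite -[RHS]mul1r -[X in _ = X * _]hh; ring.
have opp e : e * e = 1 -> (h *: ray N e) *m r *m (h *: ray N (- e)) =
    ((s%:C)%C * (h * h)) *: (A + e *: (N *m A)).
  move=> ee; rewrite rE -!scalemxAl -!scalemxAr -scalemxAl ray_sandwich_opp//.
  rewrite !scalerA; congr (_ *: _).
  by rewrite -[RHS]mul1r -[X in _ = X * _]hh; ring.
have P1 : P true = h *: ray N 1 := PE true.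
have P0 : P false = h *: ray N (- 1) := PE false.
have -> : P true *m r *m P true = ((1 + c)%:C%C * (h * h)) *: ray N 1.
  rewrite P1; apply: same; first exact: mulr1.
  by rewrite mulr1; apply/eqP; rewrite eq_complex /= addr0 !eqxx.
have -> : P false *m r *m P false = ((1 - c)%:C%C * (h * h)) *: ray N (- 1).
  rewrite P0; apply: same; first by rewrite mulrNN mulr1.
  by rewrite mulrN1; apply/eqP; rewrite eq_complex /= subr0 !eqxx.
have -> : P true *m r *m P false = ((s%:C)%C * (h * h)) *: (A + N *m A).
  by rewrite P1 P0 opp ?mulr1// scale1r.
have -> : P false *m r *m P true = ((s%:C)%C * (h * h)) *: (A - N *m A).
  by rewrite P1 P0 -[X in _ *m (_ *: ray N X)]opprK opp ?mulrNN ?mulr1// scaleN1r.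
have c1 : 0 < 1 + c by nra.
have c2 : 0 < 1 - c by nra.
have q1 : Num.sqrt ((1 + c * 1) / 2 * ((1 + c * 1) / 2)) = (1 + c) / 2.
  by rewrite !mulr1 -expr2 sqrtr_sqr ger0_norm// ltW// divr_gt0.
have q2 : Num.sqrt ((1 + c * -1) / 2 * ((1 + c * -1) / 2)) = (1 - c) / 2.
  by rewrite !mulrN1 -expr2 sqrtr_sqr ger0_norm// ltW// divr_gt0.
have q3 : Num.sqrt ((1 + c * 1) / 2 * ((1 + c * -1) / 2)) = s / 2.
  have -> : (1 + c * 1) / 2 * ((1 + c * -1) / 2) = (s / 2) ^+ 2.
    by rewrite expr_div_n s2; field.
  by rewrite sqrtr_sqr ger0_norm// ltW// divr_gt0.
have q4 : Num.sqrt ((1 + c * -1) / 2 * ((1 + c * 1) / 2)) = s / 2.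
  by rewrite mulrC.
rewrite q1 q2 q3 q4.
have d1 (u : R) : 0 < u -> (((u / 2)^-1)%:C)%C * ((u%:C)%C * (h * h)) = h.
  move=> u0; rewrite hE -!rmorphM; congr (_%:C)%C.
  by field; rewrite gt_eqF.
have -> : x * (2^-1 - 2^-1) = 0 by rewrite subrr mulr0.
have -> : x * (- 2^-1 - - 2^-1) = 0 by rewrite opprK addNr mulr0.
have -> : x * (- 2^-1 - 2^-1) = - x by field.
have -> : x * (2^-1 - - 2^-1) = x by field.
have -> : expi (0 : R) = 1 by rewrite /expi cos0 sin0.
rewrite !mul1r !scalerA -!mulrA (d1 _ c1) (d1 _ c2) (d1 _ s0).
have z1 : ((cos x)%:C)%C = (expi x + expi (- x)) * h.
  rewrite hE /expi cosN sinN; apply/eqP; rewrite eq_complex /=.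
  by apply/andP; split; apply/eqP; field.
have z2 : ((sin x)%:C)%C * - Complex 0 1 = (expi (- x) - expi x) * h.
  rewrite hE /expi cosN sinN; apply/eqP; rewrite eq_complex /=.
  by apply/andP; split; apply/eqP; field.
rewrite /rotated /quadrature scalerA z1 z2 /ray scale1r scaleN1r.
have : (1%:M : 'M[C]_2) = (h * 2) *: 1%:M by rewrite hh scale1r.
move: (1%:M : 'M[C]_2) => I EI; rewrite [I in RHS]EI.
move: (expi x) (expi (- x)) (N *m A) => z w Y; clear.
by apply/matrixP => i j; rewrite !mxE; ring.
Qed.

End Seed.

(** * The qubit state and its Bloch decomposition *)

Lemma half_sum_diff (K : numFieldType) (V : lmodType K) (c s : K) (x y : V) :
  (c - s) *: (2^-1 *: (x + y)) + (c + s) *: (2^-1 *: (x - y)) = c *: x - s *: y.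
Proof.
rewrite !scalerA !scalerDr !scalerN addrACA -!(scaleNr _ y) -(scalerDl x) -(scalerDl y).
by congr (_ *: x + _ *: y); field.
Qed.

Section QubitState.
Variables (R : realType) (n a : 'rV[R]_3).
Local Notation C := (R[i]).
Hypotheses (hn : unit_vec n) (ha : unit_vec a)
  (han : dot3 a n <> 1 /\ dot3 a n <> -1).

Definition overlap : R := dot3 a n.
Definition visibility : R := Num.sqrt (1 - overlap ^+ 2).
Definition equator : 'rV[R]_3 := visibility^-1 *: (a - overlap *: n).

Let N : 'M[C]_2 := dot_sigma n.
Let A : 'M[C]_2 := dot_sigma equator.

Lemma dot3E (u v : 'rV[R]_3) : dot3 u v = u 0 ord0 * v 0 ord0 +
  u 0 (lift ord0 ord0) * v 0 (lift ord0 ord0) +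
  u 0 (lift ord0 (lift ord0 ord0)) * v 0 (lift ord0 (lift ord0 ord0)).
Proof. by rewrite /dot3 !big_ord_recl big_ord0 addr0 addrA. Qed.

Lemma dot3_perp : dot3 (a - overlap *: n) (a - overlap *: n) = 1 - overlap ^+ 2.
Proof.
have -> : dot3 (a - overlap *: n) (a - overlap *: n) =
    dot3 a a - 2 * overlap * dot3 a n + overlap ^+ 2 * dot3 n n.
  by rewrite !dot3E !mxE; ring.
by rewrite hn ha -/overlap; ring.
Qed.

Lemma overlap_lt1 : 0 < 1 - overlap ^+ 2.
Proof.
rewrite lt_neqAle; apply/andP; split; last first.
  by rewrite -dot3_perp dot3E -!expr2 !addr_ge0 ?sqr_ge0.
rewrite eq_sym subr_eq0 eq_sym sqrf_eq1; apply/negP => /orP[] /eqP;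
  by case: han; rewrite /overlap.
Qed.

Lemma visibility_gt0 : 0 < visibility.
Proof. by rewrite sqrtr_gt0 overlap_lt1. Qed.

Lemma visibility_le1 : visibility <= 1.
Proof.
by rewrite -[X in _ <= X]sqrtr1 ler_wsqrtr// lerBlDr lerDl sqr_ge0.
Qed.

Lemma visibility2 : visibility ^+ 2 = 1 - overlap ^+ 2.
Proof. by rewrite sqr_sqrtr// ltW// overlap_lt1. Qed.

Lemma dot3_equator : dot3 equator equator = 1.
Proof.
have v0 := visibility_gt0.
have -> : dot3 equator equator = visibility ^- 2 *
    dot3 (a - overlap *: n) (a - overlap *: n).
  by rewrite !dot3E !mxE; field; rewrite gt_eqF.
by rewrite dot3_perp -visibility2 mulVf// expf_neq0// gt_eqF.
Qed.

Lemma dot3_equator_axis : dot3 equator n = 0.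
Proof.
have -> : dot3 equator n = visibility^-1 * (dot3 a n - overlap * dot3 n n).
  by rewrite !dot3E !mxE; ring.
by rewrite hn mulr1 subrr mulr0.
Qed.

Lemma bloch_decomposition : a = overlap *: n + visibility *: equator.
Proof.
rewrite /equator scalerA divff ?gt_eqF ?visibility_gt0// scale1r.
by rewrite addrC subrK.
Qed.

Lemma dot_sigma_sqr (v : 'rV[R]_3) : unit_vec v ->
  dot_sigma v *m dot_sigma v = 1%:M :> 'M[C]_2.
Proof.
move=> hv; have := dot_sigma_anticomm v v; rewrite hv mulr1 => E.
have {}E : (2 : C) *: (dot_sigma v *m dot_sigma v) = 2 *: 1%:M.
  rewrite scaler_nat mulr2n E; congr (_ *: _).
  by apply/eqP; rewrite eq_complex /= addr0 !eqxx.
by move/(congr1 (fun X => 2^-1 *: X)): E; rewrite !scalerA mulVf// !scale1r.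
Qed.

Lemma axis_sqr : N *m N = 1%:M.
Proof. exact: dot_sigma_sqr. Qed.

Lemma equator_sqr : A *m A = 1%:M.
Proof. by apply: dot_sigma_sqr; exact: dot3_equator. Qed.

Lemma equator_axis_anticomm : A *m N = - (N *m A).
Proof.
apply/eqP; rewrite -addr_eq0 dot_sigma_anticomm dot3_equator_axis mulr0.
by rewrite scale0r.
Qed.

Lemma UopE t : Uop n t = rotation N t.
Proof.
rewrite /Uop big_bool /= /Pproj /rotation -/N /eigJ.
set c : C := ((cos (t / 2))%:C)%C; set s := Complex 0 (sin (t / 2)).
have -> : expi (- t * 2^-1) = c - s.
  rewrite /expi mulNr cosN sinN /c /s.
  by apply/eqP; rewrite eq_complex /= subr0 sub0r !eqxx.
have -> : expi (- t * - 2^-1) = c + s.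
  rewrite /expi mulrNN /c /s.
  by apply/eqP; rewrite eq_complex /= addr0 add0r !eqxx.
by rewrite scale1r scaleN1r half_sum_diff.
Qed.

Lemma rhoE : rho a = 2^-1 *: (1%:M + (overlap%:C)%C *: N + (visibility%:C)%C *: A).
Proof.
by rewrite /rho [in LHS]bloch_decomposition dot_sigmaD (dot_sigmaZ overlap) (dot_sigmaZ visibility) addrA.
Qed.

Lemma rho_tE t : rho_t n a t =
  2^-1 *: (1%:M + (overlap%:C)%C *: N + (visibility%:C)%C *: rotated N A t).
Proof.
rewrite /rho_t UopE rhoE; apply: rotation_conj.
- exact: axis_sqr.
- exact: equator_axis_anticomm.
- exact: dagger_dot_sigma.
Qed.

Lemma PprojE b : Pproj n b = 2^-1 *: ray N (if b then 1 else -1).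
Proof. by []. Qed.

Lemma Pproj_rho_tr b : complex.Re (\tr (Pproj n b *m rho a)) =
  (1 + overlap * (if b then 1 else -1)) / 2.
Proof.
rewrite PprojE rhoE -scalemxAl -scalemxAr !mxtraceZ.
rewrite (tr_ray axis_sqr equator_sqr equator_axis_anticomm); last first.
  by case: b; rewrite ?mulr1 // mulrNN mulr1.
have -> : (2^-1 * (2^-1 * (2 * (1 + (overlap%:C)%C * (if b then 1 else -1)))) : C) =
    (((1 + overlap * (if b then 1 else -1)) / 2)%:C)%C.
  rewrite [2^-1 * (2 * _)]mulrA mulVf ?pnatr_eq0// mul1r mulrC.
  by case: b; rewrite !(rmorphM, rmorphD, rmorphN, rmorph1, fmorphV, rmorph_nat).
by [].
Qed.

Lemma Mstar_densE x : Mstar_dens n a x =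
  (((2 * pi)^-1)%:C)%C *: (1%:M + rotated N A x).
Proof.
rewrite /Mstar_dens; congr (_ *: _).
apply: (@seed_sum R N A axis_sqr equator_axis_anticomm overlap visibility (Pproj n) (rho a) x).
- exact: visibility_gt0.
- exact: visibility2.
- exact: PprojE.
- exact: rhoE.
- exact: Pproj_rho_tr.
Qed.

End QubitState.

(** * Moments of a POVM *)

Section POVMFacts.
Variable R : realType.
Local Notation C := (R[i]).
Implicit Types X Y H : 'M[C]_2.

Definition moment (M : set R -> 'M[C]_2) X (B : set R) : R :=
  complex.Re (\tr (M B *m X)) / 2.

Lemma psd_sandwich M X : psd M -> dagger X = X -> 0 <= \tr (X *m M *m X).
Proof.
move=> pM dX; apply: sumr_ge0 => i _.
have := pM (col i X); congr (0 <= _).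
have -> : map_mx (@conjc R) (col i X)^T = row i X.
  rewrite -[in RHS]dX; apply/matrixP => r s; rewrite !mxE; congr (conjc (X _ _)).
by rewrite -row_mul -[LHS]/((row i (X *m M) *m col i X) 0 0) !mxE; apply: eq_bigr => k _; rewrite !mxE.
Qed.

Lemma psd_involution M H : psd M -> dagger H = H -> H *m H = 1%:M ->
  0 <= complex.Re (\tr (M *m 1%:M)) / 2 + complex.Re (\tr (M *m H)) / 2.
Proof.
move=> pM dH HH.
have d1H : dagger (1%:M + H) = 1%:M + H by rewrite daggerD dagger1 dH.
have := psd_sandwich pM d1H.
rewrite mxtrace_mulC mulmxA.
have -> : (1%:M + H) *m (1%:M + H) = 1%:M + H + (1%:M + H).
  by rewrite mulmxDl !mulmxDr !mul1mx mulmx1 HH [H + _]addrC.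
rewrite mxtrace_mulC !mulmxDr !mxtraceD lecE => /andP[_].
move: (\tr (M *m 1%:M)) (\tr (M *m H)) => [x1 y1] [x2 y2] /=.
by lra.
Qed.

Section Fixed.
Variable M : set R -> 'M[C]_2.
Hypothesis hM : POVM M.

Lemma momentD X Y B : moment M (X + Y) B = moment M X B + moment M Y B.
Proof.
by rewrite /moment mulmxDr mxtraceD -mulrDl; case: (\tr _) => ? ?; case: (\tr _).
Qed.

Lemma momentZ (k : R) X B : moment M ((k%:C)%C *: X) B = k * moment M X B.
Proof.
rewrite /moment -scalemxAr mxtraceZ; case: (\tr _) => x y /=.
by rewrite mul0r subr0 mulrA.
Qed.

Lemma moment_ge0 H B : measurable B -> B `<=` @Theta R -> dagger H = H ->
  H *m H = 1%:M -> 0 <= moment M 1%:M B + moment M H B.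
Proof. by move=> mB BT dH HH; apply: psd_involution => //; apply: hM.1. Qed.

Lemma POVM_series (F : nat -> set R) r s :
  (forall k, measurable (F k)) -> (forall k, F k `<=` @Theta R) -> trivIset setT F ->
  (series (fun k => complex.Re (M (F k) r s)) @ \oo -->
     complex.Re (M (\bigcup_k F k) r s)) /\
  (series (fun k => complex.Im (M (F k) r s)) @ \oo -->
     complex.Im (M (\bigcup_k F k) r s)).
Proof.
move=> mF FT tF; have [_ [_ /(_ F mF FT tF r s)[cR cI]]] := hM.
have ReS : (fun N : nat => complex.Re (\sum_(k < N) M (F k) r s)) =
    series (fun k => complex.Re (M (F k) r s)).
  apply/funext => N; rewrite /series /= big_mkord.
  by rewrite (big_morph (@complex.Re R) (id1 := 0) (op1 := +%R))// => -[? ?] [].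
have ImS : (fun N : nat => complex.Im (\sum_(k < N) M (F k) r s)) =
    series (fun k => complex.Im (M (F k) r s)).
  apply/funext => N; rewrite /series /= big_mkord.
  by rewrite (big_morph (@complex.Im R) (id1 := 0) (op1 := +%R))// => -[? ?] [].
by split; [rewrite -ReS|rewrite -ImS].
Qed.

Lemma series_const_eq0 (l : R) : series (fun=> l) @ \oo --> l -> l = 0.
Proof.
move=> cl; have : cvgn (series (fun=> l)) by apply/cvg_ex; exists l.
move/cvg_series_cvg_0 => c0; apply: (cvg_unique _ (cvg_cst l) c0).
exact: Rhausdorff.
Qed.

Lemma series_pair (a : nat -> R) (l : R) : (forall k, a k.+2 = 0) ->
  series a @ \oo --> l -> l = a 0%N + a 1%N.
Proof.
move=> a0 cl; apply: (cvg_unique _ cl); first exact: Rhausdorff.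
apply: (@cvg_trans _ ((fun=> a 0%N + a 1%N) @ \oo)); last exact: cvg_cst.
apply: near_eq_cvg; exists 2%N => // -[|[|n]] // _.
rewrite /series /= big_nat_recl// big_nat_recl// big1 ?addr0// => i _.
Qed.

Lemma POVM_set0 : M set0 = 0.
Proof.
apply/matrixP => r s; rewrite mxE.
have [|||cR cI] := @POVM_series (fun=> set0) r s.
- by move=> _; exact: measurable0.
- by move=> _ x.
- exact: trivIset_set0.
move: cR cI; rewrite bigcup0//.
move=> /series_const_eq0 + /series_const_eq0.
by case: (M set0 r s) => x y /= -> ->.
Qed.

Lemma POVM_setU (B1 B2 : set R) : measurable B1 -> measurable B2 ->
  B1 `<=` @Theta R -> B2 `<=` @Theta R -> [disjoint B1 & B2] ->
  M (B1 `|` B2) = M B1 + M B2.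
Proof.
move=> m1 m2 T1 T2 B12; apply/matrixP => r s; rewrite mxE.
have [|||] := @POVM_series (bigcup2 B1 B2) r s.
- by move=> [|[|k]] //=.
- by move=> [|[|k]] //=; exact: sub0set.
- by rewrite -trivIset_bigcup2; exact/disj_set2P.
rewrite bigcup2E => cR cI.
have e0 k : M (bigcup2 B1 B2 k.+2) r s = 0 by rewrite /= POVM_set0 mxE.
have [] : complex.Re (M (B1 `|` B2) r s) = complex.Re (M B1 r s) + complex.Re (M B2 r s)
  /\ complex.Im (M (B1 `|` B2) r s) = complex.Im (M B1 r s) + complex.Im (M B2 r s).
  by split; [apply: (series_pair _ cR)|apply: (series_pair _ cI)] => k; rewrite e0.
case: (M (B1 `|` B2) r s) (M B1 r s) (M B2 r s) => [x y] [x1 y1] [x2 y2] /= -> ->.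
by [].
Qed.

Lemma moment_setU X (B1 B2 : set R) : measurable B1 -> measurable B2 ->
  B1 `<=` @Theta R -> B2 `<=` @Theta R -> [disjoint B1 & B2] ->
  moment M X (B1 `|` B2) = moment M X B1 + moment M X B2.
Proof.
move=> m1 m2 T1 T2 B12; rewrite /moment POVM_setU// mulmxDl mxtraceD -mulrDl.
by case: (\tr _) => ? ?; case: (\tr _).
Qed.

Lemma momentT X : moment M X (@Theta R) = complex.Re (\tr X) / 2.
Proof. by have [_ [MT _]] := hM; rewrite /moment MT mul1mx. Qed.

End Fixed.

Lemma moment_covariant n M X B g : covariant n M -> measurable B -> B `<=` @Theta R ->
  @Theta R g -> moment M X (shiftset g B) =
  moment M (Uop n g *m X *m dagger (Uop n g)) B.
Proof.
move=> cM mB BT Tg; rewrite /moment cM//; congr (complex.Re _ / _).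
by rewrite -!mulmxA mxtrace_mulC !mulmxA.
Qed.

Lemma shiftset_itv (g y : R) : 0 <= g -> 0 <= y -> g + y <= 2 * pi ->
  shiftset g `[0, y[%classic = `[g, g + y[%classic.
Proof.
move=> g0 y0 gy; have p0 : 0 < 2 * pi :> R by rewrite mulr_gt0 ?pi_gt0.
have modE (x : R) : 0 <= x < 2 * pi -> mod2pi x = x.
  move=> /andP[x0 x2]; rewrite /mod2pi (_ : Num.floor _ = 0) ?mulr0 ?subr0//.
  apply: floor_def; apply/andP; split; first by rewrite divr_ge0// ltW.
  by rewrite add0r ltr_pdivrMr// mul1r.
apply/seteqP; split => [x [t]|x] /=; rewrite !in_itv/=.
  by move=> /andP[t0 ty] ->; rewrite modE ?lerDl ?t0 ?ltrD2l// addr_ge0//= (lt_le_trans _ gy)// ltrD2l.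
move=> /andP[gx xy]; exists (x - g).
  by rewrite /= in_itv/= subr_ge0 gx ltrBlDl.
by rewrite subrKC modE// (le_trans g0)//= (lt_le_trans xy).
Qed.

End POVMFacts.

(** * Functional equations and trigonometric functions *)

Section RealLemmas.
Variable R : realType.

Lemma additive_interval (K : R -> R) (L : R) : 0 < L ->
  (forall x, 0 <= x <= L -> 0 <= K x) ->
  (forall x y, 0 <= x -> 0 <= y -> x + y <= L -> K (x + y) = K x + K y) ->
  K L = 1 -> forall x, 0 <= x <= L -> K x = x / L.
Proof.
move=> L0 K0 KD KL x /andP[x0 xL].
pose D y := K y - y / L.
have DL : D L = 0 by rewrite /D KL divff ?gt_eqF// subrr.
have DD y z : 0 <= y -> 0 <= z -> y + z <= L -> D (y + z) = D y + D z.
  by move=> y0 z0 yz; rewrite /D KD// mulrDl; ring.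
have Dbound y : 0 <= y <= L -> `|D y| <= 1.
  move=> /andP[y0 yL]; have Ly : 0 <= L - y by rewrite subr_ge0.
  have := KD _ _ y0 Ly; rewrite subrKC lexx KL => /(_ isT) K1.
  have Ky := K0 y; rewrite y0 yL in Ky.
  have KLy := K0 (L - y); rewrite Ly gerBl y0 in KLy.
  have := Ky isT; have := KLy isT => ? ?.
  have yL0 : 0 <= y / L by rewrite divr_ge0// ltW.
  have yL1 : y / L <= 1 by rewrite ler_pdivrMr// mul1r.
  by rewrite /D ler_norml; apply/andP; split; lra.
(* The period-L extension of D is additive and bounded, so n D(x) stays bounded. *)
have orbit (k : nat) : exists2 r, 0 <= r <= L & k%:R * D x = D r.
  elim: k => [|k [r /andP[r0 rL] IH]].
    exists 0; first by rewrite lexx ltW.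
    by have := DD _ _ (lexx 0) (lexx 0); rewrite addr0 (ltW L0) => /(_ isT); lra.
  have [rx|rx] := leP (r + x) L.
    exists (r + x); first by rewrite addr_ge0.
    by rewrite DD// -IH -natr1; ring.
  have Lr : 0 <= L - r by rewrite subr_ge0.
  have rxL : 0 <= r + x - L by rewrite subr_ge0 ltW.
  exists (r + x - L); first by apply/andP; split => //; lra.
  have := DD _ _ r0 Lr; rewrite subrKC lexx DL => /(_ isT) E1.
  have := DD _ _ Lr rxL; have -> : L - r + (r + x - L) = x by ring.
  by move=> /(_ xL) E2; rewrite -natr1 mulrDl mul1r IH E2; lra.
suff : D x = 0 by move=> /eqP; rewrite subr_eq0 => /eqP.
apply/eqP; apply: contraT => Dx0.
have Dx : 0 < `|D x| by rewrite normr_gt0.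
have [r rL E] := orbit (Num.bound (`|D x|^-1)).
have := Dbound _ rL; rewrite -E normrM normr_nat leNgt => /negP[].
by rewrite -ltr_pdivrMr// mul1r archi_boundP// invr_ge0.
Qed.

Lemma twisted_additive (V W : R -> R) :
  (forall y z, 0 <= y < 2 * pi -> 0 <= z -> y + z <= 2 * pi ->
     V (y + z) = V y + (cos y * V z + sin y * W z) /\
     W (y + z) = W y + (cos y * W z - sin y * V z)) ->
  forall y, 0 <= y <= 2 * pi ->
    V y = ((1 - cos y) * V pi - sin y * W pi) / 2 /\
    W y = ((1 - cos y) * W pi + sin y * V pi) / 2.
Proof.
move=> H; have p0 : 0 < pi :> R := pi_gt0 R.
have half y : 0 <= y <= pi -> V y = ((1 - cos y) * V pi - sin y * W pi) / 2 /\
    W y = ((1 - cos y) * W pi + sin y * V pi) / 2.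
  move=> /andP[y0 yp].
  have [|||E1 E2] := H y pi; [by apply/andP; split; lra|lra|lra|].
  have [|||E3 E4] := H pi y; [by apply/andP; split; lra|lra|lra|].
  move: E1 E2; rewrite [y + pi]addrC E3 E4 cospi sinpi => E1 E2.
  by split; lra.
move=> y /andP[y0 y2]; have [yp|yp] := leP y pi; first by apply: half; rewrite y0.
have [|E1 E2] := half (y - pi); [by apply/andP; split; lra|].
have [|||E3 E4] := H pi (y - pi); [by apply/andP; split; lra|lra|lra|].
move: E1 E2 E3 E4; rewrite subrKC cospi sinpi.
have -> : cos (y - pi) = - cos y by rewrite cosB cospi sinpi; ring.
have -> : sin (y - pi) = - sin y by rewrite sinB cospi sinpi; ring.
by move=> -> -> -> ->; split; field.
Qed.

Lemma polar (p q : R) : exists r t : R,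
  [/\ 0 <= r, 0 <= t <= 2 * pi, p = r * cos t & q = r * sin t].
Proof.
have [pq0|pq0] := eqVneq (p ^+ 2 + q ^+ 2) 0.
  exists 0, 0; rewrite !mul0r lexx mulr_ge0 ?pi_ge0//.
  have p2 : p ^+ 2 = 0 by have := sqr_ge0 p; have := sqr_ge0 q; lra.
  have q2 : q ^+ 2 = 0 by lra.
  by split=> //; apply/eqP; rewrite -sqrf_eq0 ?p2 ?q2.
pose r := Num.sqrt (p ^+ 2 + q ^+ 2).
have r2 : r ^+ 2 = p ^+ 2 + q ^+ 2 by rewrite sqr_sqrtr// addr_ge0 ?sqr_ge0.
have r0 : 0 < r by rewrite sqrtr_gt0 lt0r pq0 addr_ge0 ?sqr_ge0.
have pr2 : (p / r) ^+ 2 + (q / r) ^+ 2 = 1.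
  by rewrite !expr_div_n -mulrDl -r2 divff// expf_neq0// gt_eqF.
have pr1 : -1 <= p / r <= 1.
  rewrite -ler_norml -(@expr_le1 _ 2)// -normrX ger0_norm ?sqr_ge0// -pr2.
  by rewrite lerDl sqr_ge0.
have cE : cos (acos (p / r)) = p / r by rewrite acosK// in_itv.
have sE : sin (acos (p / r)) = `|q| / r.
  rewrite sin_acos//; have -> : 1 - (p / r) ^+ 2 = (q / r) ^+ 2 by rewrite -pr2; ring.
  by rewrite sqrtr_sqr normrM normfV (gtr0_norm r0).
have := acos_ge0 pr1; have := acos_lepi pr1 => t1 t0.
have [q0|q0] := leP 0 q.
  exists r, (acos (p / r)); split; [exact: ltW|by apply/andP; split; lra| |].
    by rewrite cE mulrC divfK// gt_eqF.
  by rewrite sE ger0_norm// mulrC divfK// gt_eqF.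
exists r, (2 * pi - acos (p / r)); split; [exact: ltW|by apply/andP; split; lra| |].
  by rewrite mulr_natl cosB cos2pi sin2pi cE mul1r mul0r addr0 mulrC divfK// gt_eqF.
rewrite mulr_natl sinB cos2pi sin2pi sE mul1r mul0r sub0r ltr0_norm//.
by field; rewrite gt_eqF.
Qed.

Lemma derivative_ge0_right (f : R -> R) (l e : R) : 0 < e -> is_derive (0 : R) 1 f l ->
  f 0 = 0 -> (forall x, 0 < x < e -> 0 <= f x) -> 0 <= l.
Proof.
move=> e0 [df <-] f0 fge.
have := df; rewrite /derivable => /cvg_dnbhs_at_right.
rewrite -/('D_1 f 0) f0 => cv.
apply: (cvgr_to_ge cv).
near=> h; have h0 : 0 < h by near: h; exact: nbhs_right_gt.
rewrite /= subr0 addr0 -[h *: 1]/(h * 1) mulr1; apply: mulr_ge0; first by rewrite invr_ge0 ltW.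
by apply: fge; rewrite h0; near: h; exact: nbhs_right_lt.
Unshelve. all: by end_near. Qed.

Lemma is_derive_trig (k0 k1 k2 k3 x : R) :
  is_derive x 1 (fun y => k0 + k1 * y + k2 * cos y + k3 * sin y)
    (k1 - k2 * sin x + k3 * cos x).
Proof.
have -> : (fun y => k0 + k1 * y + k2 * cos y + k3 * sin y) =
    cst k0 + (k1 \*: id) + (k2 \*: (@cos R)) + (k3 \*: (@sin R)) by [].
have d1 := is_deriveD (is_derive_cst k0 x (1 : R)) (is_deriveZ k1 (is_derive_id x (1 : R))).
have d2 := is_deriveD d1 (is_deriveZ k2 (is_derive_cos x)).
have d3 := is_deriveD d2 (is_deriveZ k3 (is_derive_sin x)).
apply: (is_derive_eq d3).
by rewrite add0r -![_ *: _]/(_ * _) mulr1 mulrN.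
Qed.

Lemma tangent_bound (P Q : R) :
  (forall t y : R, 0 < y < pi -> 0 <= y / (2 * pi) +
    (cos t * (((1 - cos y) * P - sin y * Q) / 2) +
     sin t * (((1 - cos y) * Q + sin y * P) / 2))) ->
  P ^+ 2 + Q ^+ 2 <= pi ^- 2.
Proof.
move=> H; have [r [t [r0 _ EQ EP]]] := polar Q (- P).
have r2 : P ^+ 2 + Q ^+ 2 = r ^+ 2.
  have -> : P ^+ 2 = (- P) ^+ 2 by rewrite sqrrN.
  by rewrite EP EQ -[RHS]mulr1 -(cos2Dsin2 t); ring.
suff r1 : r <= pi^-1 by rewrite r2 -exprVn lerXn2r ?nnegrE// invr_ge0 pi_ge0.
suff : 0 <= (2 * pi)^-1 + (cos t * ((0 * P - 1 * Q) / 2) + sin t * ((0 * Q + 1 * P) / 2)).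
  have -> : P = - (r * sin t) by rewrite -EP opprK.
  rewrite EQ invfM; have := cos2Dsin2 t; move: (cos t) (sin t) => c s cs.
  have -> : 2^-1 / pi + (c * ((0 * - (r * s) - 1 * (r * c)) / 2) +
      s * ((0 * (r * c) + 1 * - (r * s)) / 2)) = (pi^-1 - r * (c ^+ 2 + s ^+ 2)) / 2.
    by ring.
  by rewrite cs mulr1; lra.
have p0 : pi != 0 :> R by rewrite lt0r_neq0// pi_gt0.
apply: (@derivative_ge0_right _ _ pi (pi_gt0 R) _ _ (H t)).
- have := is_derive_trig ((cos t * P + sin t * Q) / 2) (2 * pi)^-1
    (- ((cos t * P + sin t * Q) / 2)) ((sin t * P - cos t * Q) / 2) 0.
  rewrite cos0 sin0 => /is_derive_eq h.
  rewrite (_ : (fun _ => _) = (fun y => (cos t * P + sin t * Q) / 2 + (2 * pi)^-1 * y +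
    - ((cos t * P + sin t * Q) / 2) * cos y + (sin t * P - cos t * Q) / 2 * sin y)).
    by apply: h; move: (pi) p0 => p p0; field.
  by apply/funext => y; move: (pi) p0 => p p0; field.
- by rewrite cos0 sin0; move: (pi) p0 => p p0; field.
Qed.

End RealLemmas.

(** * Integration over a period *)

Section Integrals.
Variable R : realType.
Local Notation mu := (@lebesgue_measure R).

Lemma ae_eq_primitive (f ff F : R -> R) (L : R) : 0 < L ->
  mu.-integrable `[0, L[%classic (EFin \o f) ->
  (forall y, 0 <= y <= L -> Rintegral mu `[0, y[%classic f = F y) ->
  (forall x, is_derive x (1 : R) F (ff x)) ->
  {ae mu, forall x, x \in `[0, L[ -> f x = ff x}.
Proof.
move=> L0 fi fF dF; set D := `[0, L[%classic.
pose g := f \_ D.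
have mD : measurable D by exact: measurable_itv.
have gi : mu.-integrable setT (EFin \o g).
  by have := (@integrable_mkcond _ _ _ mu D (EFin \o f) mD).1 fi; rewrite restrict_EFin.
have gloc : locally_integrable setT g by exact: integrable_locally.
have giy y : mu.-integrable [set` Interval (BLeft 0) (BRight y)] (EFin \o g).
  by apply: integrableS gi => //; exact: measurable_itv.
have h0 : {ae mu, forall x : R, x != 0}.
  exists [set 0]; split; [exact: measurable_set1|exact: lebesgue_measure_set1|].
  by move=> x /= /negP; rewrite negbK => /eqP.
have := FTC1 giy gloc.
move: h0; apply: filterS2; first exact: (ae_filter_ringOfSetsType mu).
move=> x x0 dG; rewrite in_itv/= => /andP[x_ge0 xL].
have {}x0 : 0 < x by rewrite lt_neqAle eq_sym x0.
have [|_ gx] := dG; first by rewrite lte_fin.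
have <- : g x = f x by rewrite /g patchE mem_set// /D/= in_itv/= x_ge0.
rewrite -gx derive1E.
have [_ <-] := dF x; apply: near_eq_derive.
near=> y.
have y0 : 0 < y by near: y; exact: lt_nbhsr.
have yL : y < L by near: y; exact: lt_nbhsl.
rewrite -Rintegral_itv_bndo_bndc; last first.
  by apply: integrableS gi => //; exact: measurable_itv.
rewrite -fF ?(ltW y0) ?(ltW yL)//.
apply: eq_Rintegral => z; rewrite inE/= in_itv/= => /andP[z0 zy].
by rewrite /g patchE mem_set// /D/= in_itv/= z0 (lt_trans zy).
Unshelve. all: by end_near. Qed.

Definition shift_right (c : R) : measurableTypeR R -> measurableTypeR R := fun x => x + c.

Lemma measurable_shift_right c : measurable_fun setT (shift_right c).
Proof. by apply: measurable_funD. Qed.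

HB.instance Definition _ c :=
  isMeasurableFun.Build _ _ _ _ (shift_right c) (measurable_shift_right c).

Lemma lebesgue_measure_shift (c : R) (B : set R) : measurable B ->
  mu B = pushforward mu (shift_right c) B.
Proof.
apply: lebesgue_measure_unique => _ [[a b] _ <-] /=.
rewrite /pushforward.
have -> : shift_right c @^-1` `]a, b]%classic = `]a - c, b - c]%classic.
  apply/seteqP; split => x /=; rewrite !in_itv/= /shift_right.
    by rewrite ltrBlDr lerBrDr.
  by rewrite ltrBlDr lerBrDr.
rewrite !lebesgue_measure_itv/= !lte_fin ltrD2r; case: ifP => // _.
by rewrite -!EFinB; congr EFin; ring.
Qed.

Lemma ge0_integral_shift (a b c : R) (G : R -> \bar R) :
  measurable_fun setT G -> (forall x, 0 <= G x)%E ->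
  (\int[mu]_(x in `[a, b[) G (x + c)%R = \int[mu]_(x in `[(a + c)%R, (b + c)%R[) G x)%E.
Proof.
move=> mG G0; rewrite [RHS](@eq_measure_integral _ _ _ _ (pushforward mu (shift_right c))); last first.
  by move=> B mB _; exact: lebesgue_measure_shift.
rewrite ge0_integral_pushforward//; last exact: measurable_funTS.
congr integral; apply/seteqP; split => x /=; rewrite !in_itv/= /shift_right.
  by rewrite lerD2r ltrD2r.
by rewrite lerD2r ltrD2r.
Qed.

Lemma ge0_integral_split (a b c : R) (G : R -> \bar R) : a <= b -> b <= c ->
  measurable_fun setT G -> (forall x, 0 <= G x)%E ->
  (\int[mu]_(x in `[a, c[) G x =
   \int[mu]_(x in `[a, b[) G x + \int[mu]_(x in `[b, c[) G x)%E.
Proof.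
move=> ab bc mG G0; rewrite -ge0_integral_setU//.
- by rewrite -itv_bndbnd_setU.
- exact: measurable_funTS.
- apply/disj_setPLR => x /=; rewrite !in_itv/= => /andP[_ xb].
  by rewrite leNgt xb.
Qed.

Lemma ge0_integral_periodic (T c : R) (G : R -> \bar R) : 0 <= c <= T ->
  measurable_fun setT G -> (forall x, 0 <= G x)%E -> (forall x, G (x + T)%R = G x) ->
  (\int[mu]_(x in `[0%R, T[) G (x + c)%R = \int[mu]_(x in `[0%R, T[) G x)%E.
Proof.
move=> /andP[c0 cT] mG G0 GT.
rewrite ge0_integral_shift// add0r (@ge0_integral_split c T (T + c))//; last first.
  by rewrite lerDl.
have := @ge0_integral_shift 0 c T G mG G0; rewrite add0r addrC => <-.
under [in X in (_ + X)%E]eq_integral do rewrite GT.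
by rewrite addeC -ge0_integral_split.
Qed.

Lemma measurable_ratio (D : set R) (f g : R -> R) :
  measurable_fun D f -> measurable_fun D g ->
  (forall x, 0 <= g x) -> measurable_fun D (fun x => f x / g x).
Proof.
move=> mf mg g0; apply: measurable_funM => //.
rewrite (_ : (fun x => (g x)^-1) = (fun x => g x `^ (-1))).
  exact: (measurableT_comp (measurable_powR (-1)) mg).
by apply/funext => x; rewrite powR_inv1.
Qed.

Lemma measurable_trig (a b c : R) :
  measurable_fun setT (fun x : R => a + b * cos x + c * sin x).
Proof.
have mc : measurable_fun setT (@cos R) by apply: continuous_measurable_fun; exact: continuous_cos.
have ms : measurable_fun setT (@sin R) by apply: continuous_measurable_fun; exact: continuous_sin.
by apply: measurable_funD; [apply: measurable_funD => //|]; apply: measurable_funM.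
Qed.

Definition fisher_integrand (d e a b x : R) : R :=
  (2 * pi)^-1 * ((d * cos x + e * sin x) ^+ 2 / (1 + a * cos x + b * sin x)).

Lemma trig_ge0 (a b x : R) : a ^+ 2 + b ^+ 2 <= 1 -> 0 <= 1 + a * cos x + b * sin x.
Proof.
move=> ab; have := cos2Dsin2 x; move: (cos x) (sin x) => c s cs.
have : (a * c + b * s) ^+ 2 <= 1.
  have -> : (a * c + b * s) ^+ 2 =
    (a ^+ 2 + b ^+ 2) * (c ^+ 2 + s ^+ 2) - (a * s - b * c) ^+ 2 by ring.
  by rewrite cs mulr1 lerBlDr (le_trans ab)// lerDl sqr_ge0.
by rewrite -addrA; move: (a * c + b * s) => y y1; nra.
Qed.

End Integrals.

(** * Fisher information of trigonometric densities *)

Section FisherComparison.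
Variable R : realType.
Local Notation mu := (@lebesgue_measure R).

Definition fisher_trig (d e a b : R) : \bar R :=
  (\int[mu]_(x in @Theta R) (fisher_integrand d e a b x)%:E)%E.

Lemma fisher_integrand_ge0 (d e a b x : R) : a ^+ 2 + b ^+ 2 <= 1 ->
  0 <= fisher_integrand d e a b x.
Proof.
move=> ab; apply: mulr_ge0; first by rewrite invr_ge0 mulr_ge0 ?pi_ge0.
by apply: divr_ge0; [exact: sqr_ge0|exact: trig_ge0].
Qed.

Lemma measurable_fisher_integrand (d e a b : R) : a ^+ 2 + b ^+ 2 <= 1 ->
  measurable_fun setT (fisher_integrand d e a b).
Proof.
move=> ab; apply: measurable_funM => //; apply: measurable_ratio.
- apply: measurable_funX; have := measurable_trig 0 d e.
  by congr (measurable_fun _ _); apply/funext => x; rewrite add0r.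
- exact: measurable_trig.
- by move=> x; exact: trig_ge0.
Qed.

Lemma fisher_trig_radial (a b r : R) : 0 <= r -> r ^+ 2 = a ^+ 2 + b ^+ 2 -> r <= 1 ->
  fisher_trig b (- a) a b = fisher_trig 0 r r 0.
Proof.
move=> r0 rE r1; have [r' [c [r'0 c2 aE bE]]] := polar a (- b).
have rr' : r' = r.
  apply/eqP; rewrite -(eqrXn2 (n := 2))// rE -[b ^+ 2]sqrrN aE bE.
  by rewrite -[X in X == _]mulr1 -(cos2Dsin2 c); apply/eqP; ring.
move: aE bE; rewrite {}rr' => aE bE.
have {}bE : b = - (r * sin c) by rewrite -bE opprK.
have rr : r ^+ 2 + 0 ^+ 2 <= 1 by rewrite expr0n addr0 expr_le1.
rewrite /fisher_trig /Theta -[RHS](@ge0_integral_periodic _ (2 * pi) c)//.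
- apply: eq_integral => x _; congr EFin; rewrite /fisher_integrand; congr (_ * _).
  by rewrite cosD sinD aE bE; congr (_ / _); ring.
- by apply/measurable_EFinP; exact: measurable_fisher_integrand.
- by move=> x; rewrite lee_fin fisher_integrand_ge0.
- by move=> x; rewrite /fisher_integrand mulr_natl sinD2pi cosD2pi.
Qed.

Lemma paired_le (r s C S : R) : 0 <= r -> r <= s -> s <= 1 -> C ^+ 2 + S ^+ 2 = 1 ->
  (r * S) ^+ 2 / (1 + r * C) + (r * S) ^+ 2 / (1 - r * C) <=
  (s * S) ^+ 2 / (1 + s * C) + (s * S) ^+ 2 / (1 - s * C).
Proof.
move=> r0 rs s1 CS; have [->|S0] := eqVneq S 0.
  by rewrite !mulr0 expr0n /= !mul0r.
have S2 : 0 < S ^+ 2 by rewrite exprn_even_gt0.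
have pair t : 0 <= t -> t <= 1 -> 0 < 1 - t ^+ 2 * C ^+ 2 /\
    (t * S) ^+ 2 / (1 + t * C) + (t * S) ^+ 2 / (1 - t * C) =
    2 * S ^+ 2 * (t ^+ 2 / (1 - t ^+ 2 * C ^+ 2)).
  move=> t0 t1; have C1 : -1 < C < 1 by rewrite -ltr_norml -(@expr_lt1 _ 2)// -normrX ger0_norm ?sqr_ge0//; lra.
  have [h1 h2] : 0 < 1 + t * C /\ 0 < 1 - t * C by move: C1 => /andP[]; split; nra.
  have h3 : 1 - t ^+ 2 * C ^+ 2 = (1 + t * C) * (1 - t * C) by ring.
  split; first by rewrite h3 mulr_gt0.
  by rewrite h3; field; rewrite !gt_eqF.
have [h1 ->] := pair r r0 (le_trans rs s1); have [h2 ->] := pair s (le_trans r0 rs) s1.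
apply: ler_pM => //; [by apply: mulr_ge0 => //; exact: ltW| |].
  by apply: divr_ge0; [exact: sqr_ge0|exact: ltW].
rewrite ler_pdivrMr// mulrAC ler_pdivlMr//.
suff : r ^+ 2 <= s ^+ 2 by nra.
by rewrite lerXn2r// nnegrE (le_trans r0).
Qed.

Lemma fisher_trig_mono (r s : R) : 0 <= r -> r <= s -> s <= 1 ->
  (fisher_trig 0 r r 0 <= fisher_trig 0 s s 0)%E.
Proof.
move=> r0 rs s1.
have p0 : 0 <= pi :> R := pi_ge0 R.
have paired t : 0 <= t -> t <= 1 -> fisher_trig 0 t t 0 =
   (\int[mu]_(x in `[0%R, pi[) ((fisher_integrand 0 t t 0 x) +
      (fisher_integrand 0 t t 0 (x + pi)))%:E)%E.
  move=> t0 t1; have tt : t ^+ 2 + 0 ^+ 2 <= 1 by rewrite expr0n addr0 expr_le1.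
  have mf := measurable_fisher_integrand 0 t tt.
  have f0 x := fisher_integrand_ge0 0 t x tt.
  have mG : measurable_fun setT (EFin \o fisher_integrand 0 t t 0).
    exact/measurable_EFinP.
  have G0 x : (0 <= (EFin \o fisher_integrand 0 t t 0) x)%E by rewrite lee_fin.
  have p2 : pi <= 2 * pi :> R by lra.
  rewrite /fisher_trig /Theta (ge0_integral_split p0 p2 mG G0).
  have := ge0_integral_shift 0 pi pi mG G0.
  rewrite add0r (_ : pi + pi = 2 * pi); last by ring.
  move=> <-; rewrite -ge0_integralD//.
  - exact: measurable_funTS.
  - apply: measurable_funTS.
    by apply: (measurableT_comp mG); exact: measurable_shift_right.
rewrite (paired r)//; last exact: le_trans rs s1.
rewrite (paired s)//; last exact: le_trans r0 rs.
have half (t : R) : 0 <= t -> t <= 1 -> measurable_fun `[0%R, pi[ (fun x =>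
    (fisher_integrand 0 t t 0 x + fisher_integrand 0 t t 0 (x + pi))%:E).
  move=> t0 t1; have tt : t ^+ 2 + 0 ^+ 2 <= 1 by rewrite expr0n addr0 expr_le1.
  have mf := measurable_fisher_integrand 0 t tt.
  apply/measurable_EFinP; apply: measurable_funTS; apply: measurable_funD => //.
  by apply: (measurableT_comp mf); exact: measurable_shift_right.
apply: ge0_le_integral => //.
- move=> x _; rewrite lee_fin addr_ge0// fisher_integrand_ge0// expr0n addr0 expr_le1//.
    exact: le_trans rs s1.
  exact: le_trans rs s1.
- by apply: half => //; exact: le_trans rs s1.
- by apply: half => //; exact: le_trans r0 rs.
- move=> x _; rewrite lee_fin /fisher_integrand -!mulrDr ler_wpM2l//.
    by rewrite invr_ge0 mulr_ge0.
  rewrite sinDpi cosDpi !mul0r !addr0 !add0r !mulrN !sqrrN.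
  exact: paired_le (cos2Dsin2 x).
Qed.

Lemma fisher_trigE (p : R -> R -> R) (th : R) (al be : R -> R) (d e : R) :
  (forall t, mu.-integrable (@Theta R) (fun x => (p x t)%:E)) ->
  (forall x, @Theta R x -> derivable (fun t => p x t) th 1) ->
  is_derive th (1 : R) al d -> is_derive th (1 : R) be e ->
  al th ^+ 2 + be th ^+ 2 <= 1 ->
  (forall t, {ae mu, forall x, x \in `[0, 2 * pi[ ->
     p x t = (2 * pi)^-1 * (1 + al t * cos x + be t * sin x)}) ->
  fisher p th = fisher_trig d e (al th) (be th).
Proof.
move=> pint pder dal dbe ab1 pE.
pose dp x := 'D_1 (fun t => p x t) th.
pose h (k : nat) : R := harmonic k + th.
(* Along this sequence only countably many exceptional null sets are involved. *)
have quot (f : R -> R) : derivable f th 1 ->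
    (harmonic k)^-1 * (f (h k) - f th) @[k --> \oo] --> 'D_1 f th.
  move=> df; have := df; rewrite /derivable => /cvg_dnbhs_at_right.
  rewrite -/('D_1 f th) => /cvg_at_rightP /(_ (@harmonic R)) cv.
  have := cv (conj (fun k => harmonic_gt0 k) cvg_harmonic).
  rewrite (_ : (fun k => _) = (fun k => (harmonic k)^-1 * (f (h k) - f th)))//.
  by apply/funext => k /=; rewrite -[harmonic k *: 1]/(harmonic k * 1) mulr1.
have mTheta : measurable (@Theta R) by exact: measurable_itv.
have mp t : measurable_fun (@Theta R) (fun x => p x t).
  by have /integrableP[/measurable_EFinP] := pint t.
have mdp : measurable_fun (@Theta R) dp.
  apply: (@measurable_fun_cvg _ _ _ _ (fun k x => (harmonic k)^-1 * (p x (h k) - p x th))).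
    by move=> k; apply: measurable_funM => //; exact: measurable_funB.
  by move=> x Tx; exact: (quot (fun t => p x t) (pder x Tx)).
have score x : @Theta R x ->
    derive1 (fun t => ln (p x t)) th ^+ 2 * p x th = dp x ^+ 2 / Num.max (p x th) 0.
  move=> Tx; have dpx : is_derive th (1 : R) (fun t => p x t) (dp x).
    by apply: DeriveDef => //; exact: pder.
  have pcont : {for th, continuous (fun t => p x t)}.
    by apply: differentiable_continuous; apply/derivable1_diffP; exact: pder.
  have [pneg|ppos|pz] := ltrgt0P (p x th).
  - have lnp : is_derive (p x th) (1 : R) (@ln R) (p x th)^-1 by exact: is_derive1_ln.
    rewrite derive1E (_ : (fun t => ln (p x t)) = (@ln R) \o (fun t => p x t))//.
    have [_ ->] := is_derive1_comp lnp dpx.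
    by field; rewrite gt_eqF.
  - rewrite derive1E (near_eq_derive (g := cst 0)) ?derive_cst.
      by rewrite expr0n mul0r invr0 mulr0.
    near=> t; rewrite ln0// ltW//; near: t.
    exact: (cvgr_lt _ pcont).
  - by rewrite pz mulr0 invr0 mulr0.
transitivity (\int[mu]_(x in @Theta R) (dp x ^+ 2 / Num.max (p x th) 0)%:E)%E.
  by apply: eq_integral => x /set_mem Tx; rewrite score.
have mr : measurable_fun (@Theta R) (fun x => dp x ^+ 2 / Num.max (p x th) 0).
  apply: measurable_ratio; first exact: measurable_funX.
    by apply: measurable_maxr => //; exact: measurable_cst.
  by move=> x; rewrite le_max lexx orbT.
rewrite /fisher_trig; apply: ae_eq_integral => //.
- exact/measurable_EFinP.
- apply/measurable_EFinP; apply: measurable_funTS; exact: measurable_fisher_integrand.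
have pEh : {ae mu, forall x, forall k, x \in `[0, 2 * pi[ ->
    p x (h k) = (2 * pi)^-1 * (1 + al (h k) * cos x + be (h k) * sin x)}.
  by apply: ae_foralln => k; exact: pE.
move: pEh (pE th); apply: filterS2; first exact: (ae_filter_ringOfSetsType mu).
move=> x pxh pxth Tx; congr EFin.
have pi0 : 0 < (2 * pi)^-1 :> R by rewrite invr_gt0 mulr_gt0 ?pi_gt0.
rewrite pxth// max_l; last first.
  by apply: mulr_ge0; [exact: ltW|exact: trig_ge0].
have -> : dp x = (2 * pi)^-1 * (d * cos x + e * sin x).
  have dpx := quot _ (pder x Tx).
  have dal' : (harmonic k)^-1 * (al (h k) - al th) @[k --> \oo] --> d.
    by have [alD <-] := dal; exact: quot.
  have dbe' : (harmonic k)^-1 * (be (h k) - be th) @[k --> \oo] --> e.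
    by have [beD <-] := dbe; exact: quot.
  have lim2 : (2 * pi)^-1 * ((harmonic k)^-1 * (al (h k) - al th) * cos x +
      (harmonic k)^-1 * (be (h k) - be th) * sin x) @[k --> \oo] -->
      (2 * pi)^-1 * (d * cos x + e * sin x).
    by apply: cvgMl_tmp; apply: cvgD; apply: cvgMr_tmp.
  have E : (fun k => (harmonic k)^-1 * (p x (h k) - p x th)) =
      (fun k => (2 * pi)^-1 * ((harmonic k)^-1 * (al (h k) - al th) * cos x +
      (harmonic k)^-1 * (be (h k) - be th) * sin x)).
    apply/funext => k; rewrite pxh// pxth//.
    by move: (2 * pi)^-1 (harmonic k)^-1 => u v; ring.
  by rewrite E in dpx; exact: (cvg_unique _ dpx lim2).
have : (2 * pi)^-1 != 0 :> R by rewrite gt_eqF.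
rewrite /fisher_integrand; move: (2 * pi)^-1 => u u0; rewrite invfM.
by move: (1 + _ + _)^-1 => v; field.
Unshelve. all: by end_near. Qed.

End FisherComparison.

(** * Outcome laws of covariant POVMs *)

Section CovariantLaw.
Variables (R : realType) (n a : 'rV[R]_3).
Local Notation C := (R[i]).
Hypotheses (hn : unit_vec n) (ha : unit_vec a)
  (han : dot3 a n <> 1 /\ dot3 a n <> -1).
Variable M : set R -> 'M[C]_2.
Hypotheses (hM : POVM M) (hcov : covariant n M).

Let N : 'M[C]_2 := dot_sigma n.
Let A : 'M[C]_2 := dot_sigma (equator n a).
Let Q : 'M[C]_2 := quadrature N A.
Let NN : N *m N = 1%:M := axis_sqr hn.
Let AA : A *m A = 1%:M := equator_sqr hn ha han.
Let NA : A *m N = - (N *m A) := equator_axis_anticomm a hn.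
Let dN : dagger N = N := dagger_dot_sigma n.
Let dA : dagger A = A := dagger_dot_sigma (equator n a).

Definition cdf (X : 'M[C]_2) (y : R) : R := moment M X `[0, y[%classic.

Lemma itv_sub_Theta (x y : R) : 0 <= x -> y <= 2 * pi -> `[x, y[%classic `<=` @Theta R.
Proof.
move=> x0 y2 z; rewrite /Theta /= !in_itv/= => /andP[xz zy].
by apply/andP; split; [exact: le_trans xz|exact: lt_le_trans y2].
Qed.

Lemma cdf_step X (y z : R) : 0 <= y < 2 * pi -> 0 <= z -> y + z <= 2 * pi ->
  cdf X (y + z) = cdf X y + cdf (Uop n y *m X *m dagger (Uop n y)) z.
Proof.
move=> /andP[y0 y2] z0 yz; rewrite /cdf -(moment_covariant _ hcov); first last.
- by rewrite /Theta/= in_itv/= y0 y2.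
- by apply: itv_sub_Theta => //; rewrite (le_trans _ yz)// lerDr.
- exact: measurable_itv.
rewrite (shiftset_itv y0 z0 yz) -moment_setU//.
- by congr (moment M X _); rewrite -itv_bndbnd_setU// bnd_simp ?lerDl.
- by apply: itv_sub_Theta => //; exact: ltW.
- exact: itv_sub_Theta.
- apply/disj_setPLR => x /=; rewrite !in_itv/= => /andP[_ xb].
  by rewrite leNgt xb.
Qed.

Lemma cdf0 X : cdf X 0 = 0.
Proof. by rewrite /cdf set_itvco0 /moment POVM_set0// mul0mx mxtrace0 mul0r. Qed.

Lemma cdfT X : cdf X (2 * pi) = complex.Re (\tr X) / 2.
Proof. exact: momentT. Qed.

Lemma cdf_uniform X : (forall t, Uop n t *m X *m dagger (Uop n t) = X) ->
  (forall y, 0 <= y <= 2 * pi -> 0 <= cdf X y) -> complex.Re (\tr X) = 2 ->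
  forall y, 0 <= y <= 2 * pi -> cdf X y = y / (2 * pi).
Proof.
move=> XU X0 X2; have p0 : 0 < 2 * pi :> R by rewrite mulr_gt0 ?pi_gt0.
apply: additive_interval => // [x y x0 y0 xy|]; last by rewrite cdfT X2 divff.
have [x2|x2] := ltP x (2 * pi); first by rewrite cdf_step ?x0// XU.
have -> : y = 0 by apply/eqP; rewrite eq_le y0 andbT; lra.
by rewrite cdf0 !addr0.
Qed.

Lemma cdf_pos H y : dagger H = H -> H *m H = 1%:M -> 0 <= y <= 2 * pi ->
  0 <= cdf 1%:M y + cdf H y.
Proof.
move=> dH HH /andP[y0 y2]; apply: moment_ge0 => //; exact: itv_sub_Theta.
Qed.

Lemma cdf1 y : 0 <= y <= 2 * pi -> cdf 1%:M y = y / (2 * pi).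
Proof.
apply: cdf_uniform => [t|{}y y2|]; last by rewrite tr1.
  by rewrite mulmx1 UopE; exact: rotation1.
have := cdf_pos (dagger1 R) (mulmx1 _) y2; lra.
Qed.

Lemma cdf_axis y : 0 <= y <= 2 * pi ->
  cdf 1%:M y + overlap n a * cdf N y = y / (2 * pi).
Proof.
have E z : cdf (1%:M + ((overlap n a)%:C)%C *: N) z = cdf 1%:M z + overlap n a * cdf N z.
  by rewrite /cdf momentD momentZ.
move=> y2; rewrite -E; apply: cdf_uniform y2 => [t|z z2|].
- rewrite UopE mulmxDr mulmxDl mulmx1 -scalemxAr -scalemxAl.
  by rewrite rotation1// rotationN.
- rewrite E; have h1 := cdf_pos dN NN z2.
  have h2 := cdf_pos (H := - N) _ _ z2.
  have EN : cdf (- N) z = - cdf N z.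
    have -> : - N = ((-1)%:C)%C *: N by rewrite rmorphN rmorph1 scaleN1r.
    by rewrite /cdf momentZ mulN1r.
  rewrite EN in h2.
  have {}h2 : 0 <= cdf 1%:M z - cdf N z.
    apply: h2; last by rewrite mulmxN mulNmx opprK.
    by rewrite -scaleN1r daggerZ dN -[conjc _]/(Complex _ _) oppr0.
  have := overlap_lt1 hn ha han.
  move: (cdf _ z) (cdf N z) (overlap n a) h1 h2 => u v c h1 h2 c1.
  have [c2 c3] : -1 < c /\ c < 1 by split; nra.
  nra.
- rewrite mxtraceD mxtraceZ tr1 (trN AA NA) mulr0 addr0 //.
Qed.

Lemma cdf_lin (x y : R) (X Y : 'M[C]_2) z :
  cdf ((x%:C)%C *: X + (y%:C)%C *: Y) z = x * cdf X z + y * cdf Y z.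
Proof. by rewrite /cdf momentD !momentZ. Qed.

Lemma cdf_lin3 (x y : R) (X Y Z : 'M[C]_2) z :
  cdf (X + (x%:C)%C *: Y + (y%:C)%C *: Z) z = cdf X z + x * cdf Y z + y * cdf Z z.
Proof. by rewrite /cdf !momentD !momentZ. Qed.

Lemma cdf_equator y : 0 <= y <= 2 * pi ->
  cdf A y = ((1 - cos y) * cdf A pi - sin y * cdf Q pi) / 2 /\
  cdf Q y = ((1 - cos y) * cdf Q pi + sin y * cdf A pi) / 2.
Proof.
apply: (@twisted_additive _ (cdf A) (cdf Q)) => {}y z y2 z0 yz.
rewrite !cdf_step// UopE rotationA// rotationQ//; split; congr (_ + _).
  exact: cdf_lin.
have -> : ((cos y)%:C)%C *: Q - ((sin y)%:C)%C *: A =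
    ((cos y)%:C)%C *: Q + ((- sin y)%:C)%C *: A by rewrite rmorphN scaleNr.
by rewrite cdf_lin mulNr.
Qed.

Lemma cdf_rotated t y : cdf (rotated N A t) y = cos t * cdf A y + sin t * cdf Q y.
Proof. exact: cdf_lin. Qed.

Lemma cdf_equator_bound : cdf A pi ^+ 2 + cdf Q pi ^+ 2 <= pi ^- 2.
Proof.
apply: tangent_bound => t y /andP[y0 yp].
have y2 : 0 <= y <= 2 * pi.
  by rewrite ltW//= (le_trans (ltW yp))// mulr_natl mulr2n lerDl pi_ge0.
have [<- <-] := cdf_equator y2; rewrite -cdf1// -cdf_rotated.
apply: cdf_pos => //; first exact: dagger_rotated.
exact: rotatedM.
Qed.

Lemma cdf_state t y : 0 <= y <= 2 * pi ->
  complex.Re (\tr (M `[0, y[%classic *m rho_t n a t)) =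
  y / (2 * pi) + visibility n a * (cos t * cdf A y + sin t * cdf Q y).
Proof.
move=> y2; rewrite rho_tE// -cdf_axis// -cdf_rotated.
have -> : forall X : 'M[C]_2, complex.Re (\tr (M `[0, y[%classic *m (2^-1 *: X))) = cdf X y.
  move=> X; rewrite -scalemxAr mxtraceZ /cdf /moment.
  have -> : (2^-1 : C) = ((2^-1 : R)%:C)%C by rewrite fmorphV rmorph_nat.
  by case: (\tr _) => u v /=; rewrite mul0r subr0 mulrC.
exact: cdf_lin3.
Qed.

End CovariantLaw.

Section StarLaw.
Variables (R : realType) (n a : 'rV[R]_3).
Local Notation C := (R[i]).
Local Notation mu := (@lebesgue_measure R).
Hypotheses (hn : unit_vec n) (ha : unit_vec a)
  (han : dot3 a n <> 1 /\ dot3 a n <> -1).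

Lemma integrable_trig (x y z : R) B : measurable B -> B `<=` @Theta R ->
  mu.-integrable B (EFin \o (fun t => x + y * cos t + z * sin t)).
Proof.
move=> mB BT; apply: (@integrableS _ _ _ mu `[0, 2 * pi]%classic) => //.
- by move=> t /BT; rewrite /Theta /= !in_itv/= => /andP[-> /ltW].
- apply: continuous_compact_integrable; first exact: segment_compact.
  apply: continuous_subspaceT => t.
  apply: (@continuousD _ _ _ (fun t => x + y * cos t) (fun t => z * sin t)).
    apply: (@continuousD _ _ _ (fun=> x) (fun t => y * cos t)); first exact: cvg_cst.
    by apply: (@continuousM _ _ (fun=> y) (@cos R)); [exact: cvg_cst|exact: continuous_cos].
  by apply: (@continuousM _ _ (fun=> z) (@sin R)); [exact: cvg_cst|exact: continuous_sin].
Qed.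

Lemma Rintegral_trig (k x y z : R) B : measurable B -> B `<=` @Theta R ->
  Rintegral mu B (fun t => k * (x + y * cos t + z * sin t)) =
  k * (x * Rintegral mu B (fun=> 1) + y * Rintegral mu B (@cos R) +
       z * Rintegral mu B (@sin R)).
Proof.
move=> mB BT; have i1 := integrable_trig x y z mB BT.
have ix : mu.-integrable B (EFin \o (fun=> x)).
  have := integrable_trig x 0 0 mB BT; congr (mu.-integrable B (EFin \o _)).
  by apply/funext => t; rewrite !mul0r !addr0.
have i1' : mu.-integrable B (EFin \o (fun=> (1 : R))).
  have := integrable_trig 1 0 0 mB BT; congr (mu.-integrable B (EFin \o _)).
  by apply/funext => t; rewrite !mul0r !addr0.
have ic : mu.-integrable B (EFin \o (@cos R)).
  have := integrable_trig 0 1 0 mB BT; congr (mu.-integrable B (EFin \o _)).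
  by apply/funext => t; rewrite !mul0r addr0 add0r mul1r.
have isn : mu.-integrable B (EFin \o (@sin R)).
  have := integrable_trig 0 0 1 mB BT; congr (mu.-integrable B (EFin \o _)).
  by apply/funext => t; rewrite !mul0r !add0r mul1r.
have iyc : mu.-integrable B (EFin \o (fun t => y * cos t)).
  have := integrable_trig 0 y 0 mB BT; congr (mu.-integrable B (EFin \o _)).
  by apply/funext => t; rewrite !mul0r addr0 add0r.
have izs : mu.-integrable B (EFin \o (fun t => z * sin t)).
  have := integrable_trig 0 0 z mB BT; congr (mu.-integrable B (EFin \o _)).
  by apply/funext => t; rewrite !mul0r !add0r.
have ixy : mu.-integrable B (EFin \o (fun t => x + y * cos t)).
  have := integrable_trig x y 0 mB BT; congr (mu.-integrable B (EFin \o _)).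
  by apply/funext => t; rewrite !mul0r addr0.
rewrite RintegralZl//; congr (_ * _).
rewrite RintegralD// RintegralD// !RintegralZl//.
by congr (_ + _ + _); rewrite -RintegralZl//; apply: eq_Rintegral => t _; rewrite mulr1.
Qed.

Lemma MstarE B : measurable B -> B `<=` @Theta R ->
  Mstar n a B = (((2 * pi)^-1)%:C)%C *: (
    ((Rintegral mu B (fun=> 1))%:C)%C *: 1%:M +
    ((Rintegral mu B (@cos R))%:C)%C *: dot_sigma (equator n a) +
    ((Rintegral mu B (@sin R))%:C)%C *: quadrature (dot_sigma n) (dot_sigma (equator n a))).
Proof.
move=> mB BT; apply/matrixP => r s; rewrite mxE /cint.
have E t : Mstar_dens n a t = (((2 * pi)^-1)%:C)%C *: (1%:M +
    rotated (dot_sigma n) (dot_sigma (equator n a)) t) by exact: Mstar_densE.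
have {}E t : Mstar_dens n a t r s = (((2 * pi)^-1)%:C)%C * (1%:M r s +
    ((cos t)%:C)%C * dot_sigma (equator n a) r s +
    ((sin t)%:C)%C * quadrature (dot_sigma n) (dot_sigma (equator n a)) r s).
  rewrite E /rotated; move: (dot_sigma (equator n a)) (quadrature _ _) => X Y.
  by rewrite !mxE addrA.
rewrite (_ : (fun t => complex.Re (Mstar_dens n a t r s)) = (fun t => (2 * pi)^-1 *
   (complex.Re ((1%:M : 'M[C]_2) r s) + complex.Re (dot_sigma (equator n a) r s) * cos t +
    complex.Re (quadrature (dot_sigma n) (dot_sigma (equator n a)) r s) * sin t))); last first.
  apply/funext => t; rewrite E.
  case: (1%:M r s) (dot_sigma _ r s) (quadrature _ _ r s) => [? ?] [? ?] [? ?] /=.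
  by move: (2 * pi)^-1 => k; ring.
rewrite (_ : (fun t => complex.Im (Mstar_dens n a t r s)) = (fun t => (2 * pi)^-1 *
   (complex.Im ((1%:M : 'M[C]_2) r s) + complex.Im (dot_sigma (equator n a) r s) * cos t +
    complex.Im (quadrature (dot_sigma n) (dot_sigma (equator n a)) r s) * sin t))); last first.
  apply/funext => t; rewrite E.
  case: (1%:M r s) (dot_sigma _ r s) (quadrature _ _ r s) => [? ?] [? ?] [? ?] /=.
  by move: (2 * pi)^-1 => k; ring.
rewrite !Rintegral_trig//.
move: (dot_sigma (equator n a)) (quadrature _ _) (Rintegral _ _ _) (Rintegral _ _ _)
  (Rintegral _ _ _) => X Y Is Ic I1.
rewrite [RHS](_ : _ = (((2 * pi)^-1)%:C)%C * ((I1%:C)%C * (1%:M : 'M[C]_2) r s +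
  (Ic%:C)%C * X r s + (Is%:C)%C * Y r s)); last by rewrite !mxE.
move: ((1%:M : 'M[C]_2) r s) (X r s) (Y r s) (2 * pi)^-1 => [? ?] [? ?] [? ?] k.
by apply/eqP; rewrite eq_complex /=; apply/andP; split; apply/eqP; ring.
Qed.

Lemma Mstar_law B t : measurable B -> B `<=` @Theta R ->
  \tr (Mstar n a B *m rho_t n a t) =
  ((Rintegral mu B (fun x => (2 * pi)^-1 * (1 + visibility n a * cos t * cos x +
     visibility n a * sin t * sin x)))%:C)%C.
Proof.
move=> mB BT; rewrite MstarE// rho_tE// -scalemxAl mxtraceZ tr_state.
- rewrite Rintegral_trig//; move: (2 * pi)^-1 => k.
  by apply/eqP; rewrite eq_complex /=; apply/andP; split; apply/eqP; ring.
- exact: axis_sqr.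
- exact: equator_sqr.
- exact: equator_axis_anticomm.
Qed.

End StarLaw.

Theorem theorem4 (R : realType) (n a : 'rV[R]_3)
  (hn : unit_vec n) (ha : unit_vec a)
  (han : dot3 a n <> 1 /\ dot3 a n <> -1)
  (M : set R -> 'M[R[i]]_2) (hM : POVM M) (hcov : covariant n M)
  (th : R) (hth : Theta th)
  (p q : R -> R -> R)
  (hp : regular_density n a M th p)
  (hq : regular_density n a (Mstar n a) th q) :
  (fisher p th <= fisher q th)%E.
Proof.
pose s := visibility n a.
have s0 : 0 < s := visibility_gt0 hn ha han.
have s1 : s <= 1 := visibility_le1 n a.
have p0 : 0 < pi :> R := pi_gt0 R.
have qE : fisher q th = fisher_trig 0 s s 0.
  have [qint [qlaw qder]] := hq.
  pose al t : R := s * cos t; pose be t : R := s * sin t.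
  have abE : s ^+ 2 = al th ^+ 2 + be th ^+ 2.
    by rewrite !exprMn -mulrDr cos2Dsin2 mulr1.
  rewrite -(fisher_trig_radial (ltW s0) abE s1).
  transitivity (fisher_trig (- be th) (al th) (al th) (be th)); last first.
    rewrite /fisher_trig; apply: eq_integral => x _; congr EFin.
    by rewrite /fisher_integrand; congr (_ * (_ / _)); ring.
  have dal : is_derive th (1 : R) al (- be th).
    have := is_derive_trig 0 0 s 0 th.
    rewrite (_ : (fun y => _) = al); last by apply/funext => y; rewrite /al; ring.
    by move=> /is_derive_eq h; apply: h; rewrite /be; ring.
  have dbe : is_derive th (1 : R) be (al th).
    have := is_derive_trig 0 0 0 s th.
    rewrite (_ : (fun y => _) = be); last by apply/funext => y; rewrite /be; ring.
    by move=> /is_derive_eq h; apply: h; rewrite /al; ring.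
  apply: (fisher_trigE qint qder dal dbe).
    by rewrite -abE expr_le1// ltW.
  move=> t; pose g x := (2 * pi)^-1 * (1 + al t * cos x + be t * sin x).
  have mT : measurable (@Theta R) by exact: measurable_itv.
  have gi : lebesgue_measure.-integrable (@Theta R) (EFin \o g).
    have := integrable_trig (2 * pi)^-1 ((2 * pi)^-1 * al t) ((2 * pi)^-1 * be t) mT (@subset_refl _ _).
    congr (integrable _ _ (EFin \o _)); apply/funext => x.
    by rewrite /g !mulrDr mulr1 !mulrA.
  have /integrableP[mg _] := gi.
  have [E ET mE|Z [mZ Z0 ZE]] := @integral_ae_eq _ _ _ lebesgue_measure _ mT _ _ (qint t) mg.
    have := qlaw t E mE ET; rewrite Mstar_law// => -[] eqI.
    have f1 : (\int[lebesgue_measure]_(x in E) (q x t)%:E)%E \is a fin_num.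
      by apply: integrable_fin_num => //; exact: integrableS (qint t).
    have f2 : (\int[lebesgue_measure]_(x in E) (EFin \o g) x)%E \is a fin_num.
      by apply: integrable_fin_num => //; exact: integrableS gi.
    by rewrite -(fineK f1) -(fineK f2); congr EFin; exact/esym.
  exists Z; split => // x nx; apply: ZE => h; apply: nx => xT.
  by have [] := h xT.
rewrite qE.
have [pint [plaw pder]] := hp.
pose P := cdf M (dot_sigma (equator n a)) pi.
pose Q := cdf M (quadrature (dot_sigma n) (dot_sigma (equator n a))) pi.
have PQ : P ^+ 2 + Q ^+ 2 <= pi ^- 2 by exact: cdf_equator_bound.
pose al t : R := pi * s * (sin t * P - cos t * Q).
pose be t : R := pi * s * (cos t * P + sin t * Q).
pose r := Num.sqrt (al th ^+ 2 + be th ^+ 2).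
have r0 : 0 <= r by exact: sqrtr_ge0.
have r2 : r ^+ 2 = al th ^+ 2 + be th ^+ 2 by rewrite sqr_sqrtr// addr_ge0 ?sqr_ge0.
have rs : r <= s.
  rewrite -ler_sqr ?nnegrE//; last exact: ltW.
  rewrite r2.
  have -> : al th ^+ 2 + be th ^+ 2 =
      s ^+ 2 * (pi ^+ 2 * (P ^+ 2 + Q ^+ 2)) * (cos th ^+ 2 + sin th ^+ 2).
    by rewrite /al /be; ring.
  rewrite cos2Dsin2 mulr1; apply: ler_piMr; first exact: sqr_ge0.
  by rewrite -ler_pdivlMl ?exprn_gt0// mulr1.
have -> : fisher p th = fisher_trig 0 r r 0.
  rewrite -(fisher_trig_radial r0 r2 (le_trans rs s1)).
  have dal : is_derive th (1 : R) al (be th).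
    have := is_derive_trig 0 0 (- (pi * s * Q)) (pi * s * P) th.
    rewrite (_ : (fun y => _) = al); last by apply/funext => y; rewrite /al; ring.
    by move=> /is_derive_eq h; apply: h; rewrite /be; ring.
  have dbe : is_derive th (1 : R) be (- al th).
    have := is_derive_trig 0 0 (pi * s * P) (pi * s * Q) th.
    rewrite (_ : (fun y => _) = be); last by apply/funext => y; rewrite /be; ring.
    by move=> /is_derive_eq h; apply: h; rewrite /al; ring.
  apply: (fisher_trigE pint pder dal dbe).
    by rewrite -r2 expr_le1// (le_trans rs).
  move=> t.
  apply: (@ae_eq_primitive _ _ _ (fun y => s * (cos t * P + sin t * Q) / 2 + (2 * pi)^-1 * y +
    - (s * (cos t * P + sin t * Q) / 2) * cos y + s * (sin t * P - cos t * Q) / 2 * sin y)).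
  - by rewrite mulr_gt0.
  - exact: pint.
  - move=> y y2; have := plaw t _ (measurable_itv `[0, y[) _.
    have yT : `[0, y[%classic `<=` @Theta R by apply: itv_sub_Theta => //; case/andP: y2.
    move=> /(_ yT) /(congr1 (@complex.Re R)); rewrite cdf_state// => /= <-.
    have [-> ->] := cdf_equator a hn hM hcov y2; rewrite -/P -/Q -/s.
    by move: (2 * pi)^-1 => k; field.
  - move=> x; have := is_derive_trig (s * (cos t * P + sin t * Q) / 2) (2 * pi)^-1
      (- (s * (cos t * P + sin t * Q) / 2)) (s * (sin t * P - cos t * Q) / 2) x.
    move=> /is_derive_eq h; apply: h; rewrite /al /be.
    have := lt0r_neq0 p0; move: (pi) => k k0; field.
    exact: k0.
exact: fisher_trig_mono.
Qed.
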